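(* Let $p$ be a prime number, $F(x)=x^4+a_3x^3+a_2x^2+a_1x+a_0\in\mathbb{Z}[x]$ an irreducible polynomial, $\theta$ a root of $F(x)$ in an algebraic closure of $\mathbb{Q}$, and $K=\mathbb{Q}(\theta)$. Assume that $v_p(a_0)=2$, $v_p(a_1)>1$, $v_p(a_2)\ge 1$, $v_p(a_3)\ge 1$, and that the polynomial $R(Y)=Y^2+\overline{(a_2/p)}\,Y+\overline{(a_0/p^2)}\in\mathbb{F}_p[Y]$ is inseparable. Let $y\in\mathbb{Z}_{(p)}$ be an element whose reduction modulo $p$ is the double root of $R$, let $z\in\mathbb{Z}_{(p)}$ be arbitrary, and put $\phi(x)=x^2+zpx-yp\in\mathbb{Z}_{(p)}[x]$. Let $F(x)=\phi(x)^2+A_1(x)\phi(x)+A_0(x)$ be the $\phi$-adic development of $F$ (with $A_0,A_1\in\mathbb{Z}_{(p)}[x]$ of degree $<2$), let $Q(x)=\phi(x)+A_1(x)$ be its first quotient, and let $Y\in\mathbb{Q}$ be the ordinate of the point of abscissa $1$ on the $\phi$-Newton polygon of second order of $F$. If $F(x)$ is $\phi$-regular in second order, then the elements $$1,\quad \theta,\quad \frac{Q(\theta)}{p^{\lfloor\nu\rfloor}},\quad \frac{\theta\,Q(\theta)}{p^{\lfloor\nu+(1/2)\rfloor}},\qquad \nu:=\frac{Y}{2}-1,$$ are a $p$-integral basis of the quartic field $K$.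
   Context: $v_p$ is the $p$-adic valuation with $v_p(p)=1$, $v_p(0)=\infty$. $\mathbb{Z}_{(p)}$ is the localization of $\mathbb{Z}$ at $p$. A $p$-integral basis of $K$ is a family of elements of $K$ that is a $\mathbb{Z}_{(p)}$-basis of $\mathbb{Z}_K\otimes_{\mathbb{Z}}\mathbb{Z}_{(p)}$, where $\mathbb{Z}_K$ is the ring of integers of $K$. Second order valuation: $v_p^{(2)}\big(\sum_i c_ix^i\big)=\min_i\{2v_p(c_i)+i\}$. In particular $v_p^{(2)}(m)=2v_p(m)$ for constants $m$, $v_p^{(2)}(x)=1$, $v_p^{(2)}(\phi(x))=2$. The $\phi$-Newton polygon of second order of $F$ is the lower convex envelope of the points $(0,v_p^{(2)}(A_0))$, $(1,v_p^{(2)}(A_1\phi))=(1,v_p^{(2)}(A_1)+2)$, $(2,v_p^{(2)}(\phi^2))=(2,4)$ (points with infinite ordinate omitted). Here $A_0\neq 0$ because $F$ is irreducible. Thus $Y=\min\{(v_p^{(2)}(A_0)+4)/2,\ v_p^{(2)}(A_1)+2\}$. $F$ is $\phi$-regular in second order if the second order residual polynomial attached to each side of this polygon is separable. Sides of degree one (i.e. containing no points of integer coordinates other than their two end points) always have a separable residual polynomial (of degree one). The only other possibility is that the polygon is one single side with end points $(0,V)$ and $(2,4)$, where $V=v_p^{(2)}(A_0)=2k$ is even and $k\le v_p^{(2)}(A_1)$. In that case the second order residual polynomial is, up to multiplication by a nonzero constant and rescaling of the variable by a nonzero constant, $T^2+c_1T+c_0\in\mathbb{F}_p[T]$, where, writing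 $A_0=m_0x+n_0$ and $A_1=m_1x+n_1$, $c_0=\overline{n_0/(yp)^k}$, and $c_1=\overline{n_1/(yp)^{k/2}}$ if $k$ is even, $c_1=\overline{m_1/(yp)^{(k-1)/2}}$ if $k$ is odd (bars denote reduction modulo $p$; $c_1=0$ exactly when the point of abscissa $1$ lies strictly above the side). *)

(* Defs.v *)
From HB Require Import structures.
From mathcomp Require Import all_boot all_order all_algebra all_field.
From mathcomp Require Import constructive_ereal.

Set Implicit Arguments.
Unset Strict Implicit.
Unset Printing Implicit Defensive.

Import Order.TTheory GRing.Theory Num.Theory.

Local Open Scope ring_scope.

(* Z_(p), for p prime. Reduction Z_(p) -> F_p is ratr : rat -> 'F_p. *)
Definition Zloc (p : nat) : {pred rat} := fun r => ~~ (p %| `|denq r|)%N.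

Definition vp (p : nat) (r : rat) : \bar int :=
  if r == 0 then +oo%E
  else ((logn p `|numq r|)%:Z - (logn p `|denq r|)%:Z)%:E%E.

Definition vp2 (p : nat) (P : {poly rat}) : \bar int :=
  (\big[mine/+oo]_(i < size P) (2%:E * vp p P`_i + (i%:Z)%:E))%E.

(* A lists the coefficients of the phi-adic development sum_i A_i phi^i.
   Points are (abscissa, ordinate). *)
Definition newton_points2 (p : nat) (phi : {poly rat}) (A : seq {poly rat}) :
    seq (nat * int) :=
  [seq (i, fine (vp2 p (A`_i * phi ^+ i)))
     | i <- iota 0 (size A) & vp2 p (A`_i * phi ^+ i) \is a fin_num].

Definition in_convex_hull (pts : seq (nat * int)) (t u : rat) : Prop :=
  exists w : nat * int -> rat,
    [/\ forall P, 0 <= w P,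
        \sum_(P <- pts) w P = 1,
        \sum_(P <- pts) w P * P.1%:R = t
      & \sum_(P <- pts) w P * P.2%:~R = u].

(* (t, u) lies on the lower convex envelope of pts. *)
Definition on_lower_envelope (pts : seq (nat * int)) (t u : rat) : Prop :=
  in_convex_hull pts t u /\ forall u', in_convex_hull pts t u' -> u <= u'.

Definition line_through (P Q : nat * int) (t : rat) : rat :=
  P.2%:~R + (Q.2 - P.2)%:~R / (Q.1%:R - P.1%:R) * (t - P.1%:R).

(* [P, Q] is a side of the lower convex envelope of pts; strictness outside
   [P.1, Q.1] makes it a whole side and not just a part of one. *)
Definition is_side (pts : seq (nat * int)) (P Q : nat * int) : Prop :=
  [/\ P \in pts, Q \in pts, (P.1 < Q.1)%N
    & forall S, S \in pts ->
        if (P.1 <= S.1 <= Q.1)%N then line_through P Q S.1%:R <= S.2%:~R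
        else line_through P Q S.1%:R < S.2%:~R].

Definition side_degree (P Q : nat * int) : nat :=
  gcdn (Q.1 - P.1) `|Q.2 - P.2|.

(* For a = m x + n with vp2 a >= s: the class of n / (yp)^(s/2) if s is even,
   of m / (yp)^((s-1)/2) if s is odd; it vanishes iff vp2 a > s. *)
Definition residual_coef2 (p : nat) (y : rat) (a : {poly rat}) (s : int) :
    'F_p :=
  ratr (a`_(`|(s %% 2)%Z|) / (y * p%:R) ^ (s %/ 2)%Z).

(* The side [P, Q] has side_degree P Q + 1 points with integer coordinates, and
   the one at (i, u) contributes the residual coefficient of A_i at height
   u - 2 i, since vp2 phi = 2. The formula is specific to phi of the form
   x^2 + z p x - y p with y a unit of Z_(p), and to A_i of degree < 2.
   For A = [:: A0; A1; 1], A_i = m_i x + n_i, and the side from (0, 2 k) to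
   (2, 4), this is T^2 + c_1 T + c_0 with c_0 the class of n_0 / (yp)^k and c_1
   that of n_1 / (yp)^(k/2) (k even) or m_1 / (yp)^((k-1)/2) (k odd). On a side
   of degree one it is a linear polynomial with nonzero coefficients. *)
Definition residual_poly2 (p : nat) (y : rat) (A : seq {poly rat})
    (P Q : nat * int) : {poly 'F_p} :=
  let d := side_degree P Q in
  \poly_(j < d.+1)
    let i := (P.1 + j * ((Q.1 - P.1) %/ d))%N in
    let u := P.2 + j%:Z * ((Q.2 - P.2) %/ d%:Z)%Z in
    residual_coef2 p y A`_i (u - 2 * i%:Z).

Definition phi_regular2 (p : nat) (y : rat) (phi : {poly rat})
    (A : seq {poly rat}) : Prop :=
  forall P Q, is_side (newton_points2 p phi A) P Q ->
    separable_poly (residual_poly2 p y A P Q).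

(* The field Q(theta). *)
Definition Qadjoin (theta : algC) (x : algC) : Prop :=
  exists f g : {poly rat},
    (map_poly ratr g).[theta] != 0 /\
    x = (map_poly ratr f).[theta] / (map_poly ratr g).[theta].

(* For a subfield K of algC, the ring Z_K tensor Z_(p), seen inside K. *)
Definition int_closure_loc (p : nat) (K : algC -> Prop) (x : algC) : Prop :=
  exists (a : algC) (m : nat),
    [/\ K a, a \in Aint, ~~ (p %| m)%N & x = a / m%:R].

Definition p_integral_basis (p : nat) (K : algC -> Prop) (n : nat)
    (b : n.-tuple algC) : Prop :=
  (forall i, int_closure_loc p K (tnth b i)) /\
  (forall x, int_closure_loc p K x ->
     exists! c : 'rV[rat]_n,
       (forall i, c 0 i \in Zloc p) /\
       x = \sum_(i < n) ratr (c 0 i) * tnth b i).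

(* Main.v *)
Require Import Defs.
From HB Require Import structures.
From mathcomp Require Import all_boot all_order all_algebra all_field.
From mathcomp Require Import constructive_ereal.
From mathcomp Require Import ring lra zify.

(** Let [Phi = Q(theta)] and [h = 4 * nu], which is an integer. On the [rat]-basis
    [1, theta, Phi, theta * Phi] of [K] take the weight [w] equal to [4 * v_p] on
    rational numbers, with [w theta = 2] and [w Phi = h], and extend it by the
    minimum over the four coordinates; [weight_ge n al] means [n <= w al]. The
    claim is that an element of [K] is integral at [p] if and only if its weight
    is nonnegative. A coordinate along a basis element of weight [e] may then
    have any valuation at least [- e / 4], and rounding [h / 4 = nu] and
    [(h + 2) / 4 = nu + 1 / 2] down gives the exponents in the basis.

    Since [F = phi * Q + A0] and [Q = phi + A1], the pair [theta, Phi] satisfies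
    [theta ^ 2 = y p + (terms of higher weight) + Phi] and
    [Phi ^ 2 = A1(theta) * Phi - A0(theta)]. Comparing the coefficients of [F]
    with those of its development, the double root of [R] forces the second order
    valuations of [A0] and [A1] above 4 and 2, hence [h > 4]; and the polygon gives
    [h = min (v2 A0) (2 * v2 A1)], so every term of [Phi ^ 2] has weight at least
    [2 * h]. Therefore the weight of a product is at least the sum of the weights
    ([weight_geM]), the elements of nonnegative weight form a ring which is finite
    over [Z_(p)], and they are integral at [p] by the determinant trick
    ([Aint_of_Zloc_module]).

    Conversely, it is enough that squaring doubles the weight exactly, that is,
    that the associated graded ring is reduced ([sqr_strict_regular]): the powers
    of an integral element of [K] have bounded weights, which excludes a negative
    weight ([weight_ge0_of_Aint]). In the graded ring [theta] is invertible, so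
    only the degrees 0 and 1 matter. If [h] is odd each of them is a line over
    ['F_p], generated by an element whose square is not zero. If [h] is even the
    degree 0 is ['F_p[T]] modulo the second order residual polynomial (up to the
    sign of [T]), and it is reduced because this polynomial is separable: by
    regularity if the polygon has a single side, and because its two roots are
    then 0 and a nonzero element if the polygon has two sides
    ([regular_residue_polygon]). *)

Set Implicit Arguments.
Unset Strict Implicit.
Unset Printing Implicit Defensive.

Import Order.TTheory GRing.Theory Num.Theory.

Local Open Scope ring_scope.

(** * The ring [Z_(p)] and its residue field *)

Section Localization.

Variable p : nat.
Hypothesis p_pr : prime p.

Let p_neq0 : p%:R != 0 :> rat.
Proof. by rewrite pnatr_eq0 -lt0n prime_gt0. Qed.

Let pN_neq0 n : ~~ (p %| n)%N -> n != 0%N.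
Proof. by apply: contraNneq => ->; rewrite dvdn0. Qed.

Let nat_neq0 n : ~~ (p %| n)%N -> n%:R != 0 :> rat.
Proof. by rewrite pnatr_eq0; apply: pN_neq0. Qed.

Let numq_frac (a : int) (b : nat) (r := a%:~R / b%:R : rat) :
  b != 0%N -> numq r * b%:Z = a * denq r.
Proof.
move=> b_neq0; have /eqP := divq_num_den r.
rewrite {3}/r eqr_div ?intr_eq0 ?denq_eq0 ?pnatr_eq0 // pmulrn -!rmorphM /=.
by move/eqP/intr_inj.
Qed.

Lemma ZlocP (r : rat) :
  reflect (exists (a : int) (b : nat), ~~ (p %| b)%N /\ r = a%:~R / b%:R)
          (r \in Zloc p).
Proof.
apply: (iffP idP) => [r_loc | [a [b [pNb def_r]]]].
  exists (numq r), `|denq r|%N; split=> //.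
  by rewrite -{1}(divq_num_den r) natr_absz normr_denq.
have := numq_frac a (pN_neq0 pNb); rewrite -def_r.
move/(congr1 absz); rewrite !abszM /= => eq_ab.
have : (`|denq r| %| `|numq r| * b)%N by rewrite eq_ab dvdn_mull.
rewrite Gauss_dvdr; last by rewrite coprime_sym coprime_num_den.
by move=> dvd_b; apply: contra pNb => /dvdn_trans; apply.
Qed.

Lemma Zloc_int (a : int) : a%:~R \in Zloc p.
Proof.
apply/ZlocP; exists a, 1%N; split; last by rewrite divr1.
by rewrite dvdn1 neq_ltn prime_gt1 ?orbT.
Qed.

Lemma ZlocD r s : r \in Zloc p -> s \in Zloc p -> r + s \in Zloc p.
Proof.
move=> /ZlocP[a [b [pNb ->]]] /ZlocP[c [d [pNd ->]]].
apply/ZlocP; exists (a * d%:Z + c * b%:Z), (b * d)%N.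
rewrite Euclid_dvdM // negb_or pNb pNd; split=> //.
by rewrite natrM; move: (nat_neq0 pNb) (nat_neq0 pNd) => *; field; apply/andP.
Qed.

Lemma ZlocM r s : r \in Zloc p -> s \in Zloc p -> r * s \in Zloc p.
Proof.
move=> /ZlocP[a [b [pNb ->]]] /ZlocP[c [d [pNd ->]]].
apply/ZlocP; exists (a * c), (b * d)%N.
rewrite Euclid_dvdM // negb_or pNb pNd; split=> //.
by rewrite natrM mulf_div rmorphM.
Qed.

Lemma Zloc_nat n : n%:R \in Zloc p.
Proof. exact: (Zloc_int n). Qed.

Lemma ZlocN r : r \in Zloc p -> - r \in Zloc p.
Proof. by move=> r_loc; rewrite -mulN1r ZlocM // (Zloc_int (-1)). Qed.

Lemma ZlocB r s : r \in Zloc p -> s \in Zloc p -> r - s \in Zloc p.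
Proof. by move=> ? ?; rewrite ZlocD ?ZlocN. Qed.

Lemma ZlocX r n : r \in Zloc p -> r ^+ n \in Zloc p.
Proof.
move=> r_loc; elim: n => [|n IHn]; first exact: Zloc_nat 1.
by rewrite exprS ZlocM.
Qed.

Lemma Zloc_exprz r (k : int) :
  r \in Zloc p -> r^-1 \in Zloc p -> r ^ k \in Zloc p.
Proof.
by case: k => n r_loc rV_loc; rewrite ?NegzE -?exprnN -?exprVn; apply: ZlocX.
Qed.

Lemma Zloc_natV n : ~~ (p %| n)%N -> n%:R^-1 \in Zloc p.
Proof. by move=> pNn; apply/ZlocP; exists 1, n; rewrite mul1r. Qed.

Lemma Zloc_ppow (k : int) : 0 <= k -> p%:R ^ k \in Zloc p.
Proof. by case: k => // n _; rewrite -exprnP -natrX Zloc_nat. Qed.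

Let Fp_nat_eq0 n : (n%:R == 0 :> 'F_p) = (p %| n)%N.
Proof. by rewrite (dvdn_pcharf (pchar_Fp p_pr)). Qed.

Let Fp_int_eq0 (a : int) : (a%:~R == 0 :> 'F_p) = (p %| `|a|)%N.
Proof. by case: a => n; rewrite ?NegzE ?mulrNz ?oppr_eq0 -?pmulrn Fp_nat_eq0 ?abszN. Qed.

Lemma ratr_Fp_frac (a : int) (b : nat) : ~~ (p %| b)%N ->
  ratr (a%:~R / b%:R) = a%:~R / b%:R :> 'F_p.
Proof.
move=> pNb; set r := a%:~R / b%:R.
have r_loc : r \in Zloc p by apply/ZlocP; exists a, b.
have eq_ab := numq_frac a (pN_neq0 pNb); rewrite -/r in eq_ab.
rewrite /ratr; apply/eqP; rewrite eqr_div ?Fp_nat_eq0 //; last first.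
  by rewrite Fp_int_eq0; exact: r_loc.
by rewrite pmulrn -!rmorphM /= eq_ab.
Qed.

Lemma ratr_FpD r s : r \in Zloc p -> s \in Zloc p ->
  ratr (r + s) = ratr r + ratr s :> 'F_p.
Proof.
move=> /ZlocP[a [b [pNb ->]]] /ZlocP[c [d [pNd ->]]].
have -> : a%:~R / b%:R + c%:~R / d%:R
          = (a * d%:Z + c * b%:Z)%:~R / (b * d)%:R :> rat.
  rewrite natrM rmorphD !rmorphM /= -!pmulrn.
  by rewrite addf_div ?nat_neq0.
rewrite !ratr_Fp_frac ?Euclid_dvdM ?negb_or ?pNb //.
by rewrite addf_div ?Fp_nat_eq0 // natrM rmorphD !rmorphM.
Qed.

Lemma ratr_FpM r s : r \in Zloc p -> s \in Zloc p ->
  ratr (r * s) = ratr r * ratr s :> 'F_p.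
Proof.
move=> /ZlocP[a [b [pNb ->]]] /ZlocP[c [d [pNd ->]]].
have -> : a%:~R / b%:R * (c%:~R / d%:R) = (a * c)%:~R / (b * d)%:R :> rat.
  by rewrite natrM rmorphM mulf_div.
rewrite !ratr_Fp_frac ?Euclid_dvdM ?negb_or ?pNb //.
by rewrite mulf_div natrM rmorphM.
Qed.

Lemma ratr_FpN r : r \in Zloc p -> ratr (- r) = - ratr r :> 'F_p.
Proof.
move=> r_loc; rewrite -mulN1r ratr_FpM ?(Zloc_int (-1)) //.
by rewrite (ratr_int _ (-1)) mulrNz mulN1r.
Qed.

Lemma ratr_Fp_eq0 r : r \in Zloc p ->
  (ratr r == 0 :> 'F_p) = (r / p%:R \in Zloc p).
Proof.
move=> /ZlocP[a [b [pNb ->]]].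
rewrite ratr_Fp_frac // mulf_eq0 invr_eq0 Fp_nat_eq0 (negPf pNb) orbF Fp_int_eq0.
apply/idP/idP => [/dvdnP[q def_a] | ].
  apply/ZlocP; exists (sgz a * q%:Z), b; split=> //.
  rewrite [a in LHS]intEsg def_a PoszM !rmorphM /= -!pmulrn.
  by rewrite mulrA mulrAC mulfK // mulrAC.
move=> /ZlocP[c [d [pNd]]] eq_ac.
have : (a * d%:Z = c * (b * p)%N%:Z)%R.
  apply: (@intr_inj rat); rewrite PoszM !rmorphM /= -!pmulrn.
  move/eqP: eq_ac; rewrite -mulrA -invfM eqr_div ?mulf_neq0 ?p_neq0 ?nat_neq0 //.
  by move/eqP.
move/(congr1 absz); rewrite !abszM /= => eq_n.
have : (p %| `|a| * d)%N by rewrite eq_n mulnA dvdn_mull.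
by rewrite Euclid_dvdM // (negPf pNd) orbF.
Qed.

Lemma Zloc_inv u : u \in Zloc p -> u / p%:R \notin Zloc p -> u^-1 \in Zloc p.
Proof.
move=> u_loc; rewrite -ratr_Fp_eq0 //.
case/ZlocP: u_loc => a [b [pNb ->]].
rewrite ratr_Fp_frac // mulf_eq0 invr_eq0 Fp_nat_eq0 (negPf pNb) orbF Fp_int_eq0.
move=> pNa; apply/ZlocP; exists (sgz a * b%:Z), `|a|%N; split=> //.
rewrite [a in LHS]intEsg !rmorphM /= -!pmulrn !invfM invrK mulrAC.
by congr (_ * _ / _); case: (sgzP a); rewrite ?invr0 ?invr1 // rmorphN1 invrN invr1.
Qed.

(** * Valuations *)

Let vp_frac (a : int) (b : nat) : a != 0 -> b != 0%N ->
  vp p (a%:~R / b%:R) = ((logn p `|a|)%:Z - (logn p b)%:Z)%:E%E.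
Proof.
move=> a_neq0 b_neq0; rewrite /vp; set r := _ / _.
have r_neq0 : r != 0 by rewrite mulf_neq0 ?intr_eq0 ?invr_eq0 ?pnatr_eq0.
rewrite (negPf r_neq0); congr (_%:E)%E.
have eq_ab : numq r * b%:Z = a * denq r := numq_frac a b_neq0.
have /(congr1 (logn p)) := congr1 absz eq_ab; rewrite !abszM /=.
rewrite !lognM ?absz_gt0 ?numq_eq0 ?denq_eq0 ?lt0n //; lia.
Qed.

Let vpMp (k : int) r : r != 0 -> vp p (r / p%:R ^ k) = (vp p r - k%:E)%E.
Proof.
move=> r_neq0; have [a [b [n_neq0 d_neq0 ->]]] :
    exists (a : int) (b : nat), [/\ a != 0, b != 0%N & r = a%:~R / b%:R].
  exists (numq r), `|denq r|%N.
  by rewrite numq_eq0 absz_eq0 denq_eq0 natr_absz normr_denq divq_num_den.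
have pn_neq0 n : (p ^ n)%N != 0%N by rewrite -lt0n expn_gt0 prime_gt0.
rewrite [X in (X - _)%E]vp_frac //; case: k => n; rewrite ?NegzE.
  rewrite -exprnP -natrX -mulrA -invfM -natrM vp_frac;
    rewrite ?muln_eq0 ?negb_or ?d_neq0 ?pn_neq0 //.
  rewrite lognM ?lt0n // pfactorK // -EFinB; congr (_%:E)%E; lia.
rewrite -exprnN invrK -natrX mulrAC pmulrn -rmorphM /= vp_frac ?mulf_neq0 ?pn_neq0 //.
rewrite abszM lognM ?absz_gt0 ?pn_neq0 //= pfactorK // -EFinB.
congr (_%:E)%E; lia.
Qed.

Let Zloc_vp r : (r \in Zloc p) = (0%:E <= vp p r)%E.
Proof.
have [-> | r_neq0] := eqVneq r 0; first by rewrite (Zloc_int 0) /vp eqxx leey.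
rewrite /vp (negPf r_neq0) lee_fin subr_ge0 unfold_in.
apply/idP/idP => [pNd | ].
  by rewrite (_ : logn p `|denq r| = 0%N) // lognE (negPf pNd) !andbF.
apply: contraL => dvd_d; rewrite -ltNge ltz_nat.
rewrite (_ : logn p `|numq r| = 0%N); last first.
  rewrite lognE; case: (boolP (p %| `|numq r|)%N); rewrite ?andbF // => dvd_n.
  suff: ~~ (p %| `|numq r|)%N by rewrite dvd_n.
  rewrite -prime_coprime //; apply: coprime_dvdl dvd_d _.
  by rewrite coprime_sym coprime_num_den.
by rewrite logn_gt0 mem_primes p_pr absz_gt0 denq_eq0.
Qed.

Lemma vp_ge (k : int) r : (k%:E <= vp p r)%E = (r / p%:R ^ k \in Zloc p).
Proof.
have [-> | r_neq0] := eqVneq r 0.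
  by rewrite mul0r (Zloc_int 0) /vp eqxx leey.
by rewrite Zloc_vp vpMp //= /vp (negPf r_neq0) -EFinB !lee_fin subr_ge0.
Qed.

(** A lower bound for [4 * v_p c]; with the factor 4 all weights below are
    integers, and the existential form makes sums of bounds immediate. *)
Definition val4_ge (e : int) (c : rat) : Prop :=
  exists2 k : int, e <= 4 * k & c / p%:R ^ k \in Zloc p.

Lemma val4_geE (k e : int) c : 4 * (k - 1) < e -> e <= 4 * k ->
  val4_ge e c <-> c / p%:R ^ k \in Zloc p.
Proof.
move=> lt_ke le_ek; split=> [[k' le_ek' c_loc] | c_loc]; last by exists k.
have def_c : c / p%:R ^ k = c / p%:R ^ k' * (p%:R ^ k' / p%:R ^ k).
  by rewrite mulrA divfK ?expfz_neq0.
rewrite def_c ZlocM // invr_expz -expfzDr //; apply: Zloc_ppow; lia.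
Qed.

Lemma val4_ge0 e : val4_ge e 0.
Proof. by exists `|e|; [lia | rewrite mul0r (Zloc_int 0)]. Qed.

(** Valuations being integers, a bound may be rounded up to a multiple of 4.
    This is what turns the inequalities between weights into strict ones. *)
Lemma val4_ge_round (k e e' : int) c :
  val4_ge e c -> 4 * k < e -> e' <= 4 * (k + 1) -> val4_ge e' c.
Proof.
case=> k' le_ek' c_loc lt_ke le_e'; exists k' => //; lia.
Qed.

Lemma val4_ge_le e e' c : val4_ge e c -> e' <= e -> val4_ge e' c.
Proof. by case=> k le_ek c_loc le_e; exists k => //; apply: le_trans le_ek. Qed.

Lemma val4_geD e c d : val4_ge e c -> val4_ge e d -> val4_ge e (c + d).
Proof.
move=> c_ge d_ge; set k := - ((- e) %/ 4)%Z.
have [lt_k le_k] : 4 * (k - 1) < e /\ e <= 4 * k.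
  have := divz_eq (- e) 4; have := @modz_ge0 (- e) 4; have := @ltz_pmod (- e) 4.
  rewrite /k; lia.
apply/(val4_geE _ lt_k le_k); rewrite mulrDl.
by apply: ZlocD; apply/(val4_geE _ lt_k le_k).
Qed.

Lemma val4_geN e c : val4_ge e c -> val4_ge e (- c).
Proof. by case=> k le_ek c_loc; exists k; rewrite // mulNr ZlocN. Qed.

Lemma val4_geB e c d : val4_ge e c -> val4_ge e d -> val4_ge e (c - d).
Proof. by move=> c_ge d_ge; apply/val4_geD/val4_geN. Qed.

Lemma val4_geM e f c d : val4_ge e c -> val4_ge f d -> val4_ge (e + f) (c * d).
Proof.
case=> k le_ek c_loc [l le_fl d_loc]; exists (k + l); first by lia.
by rewrite expfzDr // invfM mulrACA ZlocM.
Qed.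

Lemma val4_ge_loc c : val4_ge 0 c <-> c \in Zloc p.
Proof. by rewrite (@val4_geE 0) // expr0z divr1. Qed.

Lemma val4_ge_ppow (k : int) : val4_ge (4 * k) (p%:R ^ k).
Proof. by exists k; rewrite // divff ?expfz_neq0 // (Zloc_int 1). Qed.

Lemma val4_ge_vp (k : int) c : (k%:E <= vp p c)%E <-> val4_ge (4 * k) c.
Proof. by rewrite vp_ge (@val4_geE k) //; lia. Qed.

Lemma val4_ge_divp e c :
  0 < e -> e <= 4 -> val4_ge e c <-> c / p%:R \in Zloc p.
Proof. by move=> e_gt0 e_le4; rewrite (@val4_geE 1) // expr1z. Qed.

Lemma val4_ge_unitz y (k : int) : y \in Zloc p -> y^-1 \in Zloc p ->
  val4_ge (4 * k) ((y * p%:R) ^ k).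
Proof.
move=> y_loc yV_loc; rewrite expfzMl -[4 * k]add0r.
by apply: val4_geM (val4_ge_ppow k); apply/val4_ge_loc/Zloc_exprz.
Qed.

End Localization.

Lemma modz2P (s : int) :
  (s %% 2)%Z = 0 /\ s = 2 * (s %/ 2)%Z \/
  (s %% 2)%Z = 1 /\ s = 2 * (s %/ 2)%Z + 1.
Proof.
have := divz_eq s 2; have := @modz_ge0 s 2; have := @ltz_pmod s 2.
by move: (s %% 2)%Z (s %/ 2)%Z => r q; lia.
Qed.

(** * The weight filtration *)

(** A double root of [T ^+ 2 - C1 * T - C0] modulo [p] would be the class of
    [- t]. *)
Definition residually_separable (p : nat) (C0 C1 : rat) : Prop :=
  forall t, t \in Zloc p -> (t ^+ 2 + C0) / p%:R \in Zloc p ->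
    (2 * t + C1) / p%:R \in Zloc p -> False.

(** Of the two terms of [n1 + m1 * 'X], only the constant one can have an even
    second order valuation and only the other one an odd one. *)
Definition residue_c1 (p : nat) (y n1 m1 : rat) (s : int) : rat :=
  (if (s %% 2)%Z == 0 then n1 else m1) / (y * p%:R) ^ (s %/ 2)%Z.

(** The determinant trick: multiplication by [al] on a finitely generated
    [Z_(p)]-module has, after clearing denominators prime to [p], an integer
    matrix, and [al] is an eigenvalue of it. *)
Lemma Aint_of_Zloc_module (p : nat) (p_pr : prime p) n (e : n.-tuple algC)
    (al : algC) :
  (exists i, tnth e i != 0) ->
  (forall i, exists c : 'I_n -> rat, (forall j, c j \in Zloc p) /\
     al * tnth e i = \sum_(j < n) ratr (c j) * tnth e j) ->
  exists m : nat, ~~ (p %| m)%N /\ al * m%:R \in Aint.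
Proof.
move=> [i0 nz_e] /fin_all_exists[c c_prop].
pose m := (\prod_(i < n) \prod_(j < n) `|denq (c i j)|)%N.
have m_int i j : exists k : int, m%:R * c i j = k%:~R.
  exists ((m %/ `|denq (c i j)|)%N%:Z * numq (c i j)).
  have dvd_m : (`|denq (c i j)| %| m)%N.
    by rewrite /m (bigD1 i) //= dvdn_mulr // (bigD1 j) //= dvdn_mulr.
  rewrite rmorphM /= -pmulrn -{1}(divnK dvd_m) natrM -mulrA; congr (_ * _).
  by rewrite natr_absz normr_denq mulrC -{1}[c i j]divq_num_den divfK ?intr_eq0 ?denq_eq0.
have /fin_all_exists[k k_prop] : forall ij : 'I_n * 'I_n,
    exists k : int, m%:R * c ij.1 ij.2 = k%:~R by move=> [i j]; exact: m_int.
exists m; split.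
  have pN1 : ~~ (p %| 1)%N by rewrite dvdn1 neq_ltn prime_gt1 ?orbT.
  have pNM x x' : ~~ (p %| x)%N -> ~~ (p %| x')%N -> ~~ (p %| x * x')%N.
    by rewrite Euclid_dvdM // negb_or => -> ->.
  apply: (big_ind (fun x => ~~ (p %| x)%N)) => // i _.
  apply: (big_ind (fun x => ~~ (p %| x)%N)) => // j _.
  by have [+ _] := c_prop i; apply.
pose B : 'M[int]_n := \matrix_(j, i) k (i, j).
pose BC := map_mx (intr : int -> algC) B.
apply: (@root_monic_Aint (char_poly BC)) (char_poly_monic _) _; last first.
  rewrite -map_char_poly; apply/polyOverP => i.
  by rewrite coef_map /= rpred_int.
rewrite -eigenvalue_root_char; apply/eigenvalueP.
exists (\row_i tnth e i); last first.
  by apply: contraNneq nz_e => /rowP/(_ i0); rewrite !mxE => ->.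
apply/rowP => i; rewrite !mxE mulrAC (c_prop i).2 mulr_suml; apply: eq_bigr => j _.
rewrite !mxE -(ratr_int _ (k _)) -(k_prop (i, j)) rmorphM /= ratr_nat.
by ring.
Qed.

(** For [Phi = Q(theta)] the rational numbers [n0, m0] are the coefficients of
    [- A0] and [n1, m1] those of [A1]; the hypotheses on them say that
    [Phi ^+ 2] has weight at least [2 * h]. *)
Section Filtration.

Variables (p : nat) (theta Phi : algC) (h : int) (y g0 g1 n0 m0 n1 m1 : rat).

Hypothesis p_pr : prime p.
Hypotheses (y_neq0 : y != 0) (y_loc : y \in Zloc p) (yV_loc : y^-1 \in Zloc p).
Hypothesis h_gt4 : 4 < h.
Hypothesis sqr_theta :
  theta ^+ 2 = ratr (y * p%:R + g0) + ratr g1 * theta + Phi.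
Hypotheses (g0_ge : val4_ge p 5 g0) (g1_ge : val4_ge p 3 g1).
Hypothesis sqr_Phi :
  Phi ^+ 2 = ratr n0 + ratr m0 * theta + (ratr n1 + ratr m1 * theta) * Phi.
Hypotheses (n0_ge : val4_ge p (2 * h) n0) (m0_ge : val4_ge p (2 * h - 2) m0).
Hypotheses (n1_ge : val4_ge p h n1) (m1_ge : val4_ge p (h - 2) m1).

Definition lincomb4 (a b c d : rat) : algC :=
  ratr a + ratr b * theta + (ratr c + ratr d * theta) * Phi.

Hypothesis free4 : forall a b c d, lincomb4 a b c d = 0 ->
  [/\ a = 0, b = 0, c = 0 & d = 0].

Definition weight_ge (n : int) (al : algC) : Prop :=
  exists a b c d,
    [/\ val4_ge p n a, val4_ge p (n - 2) b, val4_ge p (n - h) c,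
        val4_ge p (n - h - 2) d & al = lincomb4 a b c d].

Let p_neq0 : p%:R != 0 :> rat.
Proof. by rewrite pnatr_eq0 -lt0n prime_gt0. Qed.

Lemma weight_ge_le n n' al : weight_ge n al -> n' <= n -> weight_ge n' al.
Proof.
case=> a [b [c [d [ha hb hc hd ->]]]] le_n; exists a, b, c, d.
by split=> //; [apply: val4_ge_le ha _ | apply: val4_ge_le hb _
  | apply: val4_ge_le hc _ | apply: val4_ge_le hd _]; lia.
Qed.

Lemma weight_geD n al be :
  weight_ge n al -> weight_ge n be -> weight_ge n (al + be).
Proof.
case=> a [b [c [d [ha hb hc hd ->]]]] [a' [b' [c' [d' [ha' hb' hc' hd' ->]]]]].
exists (a + a'), (b + b'), (c + c'), (d + d').
by split; rewrite ?/lincomb4; try exact: val4_geD; rewrite /lincomb4; ring.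
Qed.

Lemma weight_geZ e n r al :
  val4_ge p e r -> weight_ge n al -> weight_ge (e + n) (ratr r * al).
Proof.
move=> r_ge [a [b [c [d [ha hb hc hd ->]]]]].
exists (r * a), (r * b), (r * c), (r * d).
by split; rewrite -?addrA; try (apply: val4_geM => //; rewrite ?addrA //);
   rewrite /lincomb4; ring.
Qed.

Lemma weight_geZ_le e n n' r al : val4_ge p e r -> weight_ge n al ->
  n' <= e + n -> weight_ge n' (ratr r * al).
Proof. by move=> r_ge al_ge; apply/weight_ge_le/weight_geZ. Qed.

Lemma weight_geN n al : weight_ge n al -> weight_ge n (- al).
Proof.
move=> al_ge; have := @weight_geZ_le 0 n n (-1) al.
rewrite rmorphN1 mulN1r; apply=> //; last by rewrite add0r.
by apply/val4_ge_loc => //; exact: (Zloc_int p_pr (-1)).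
Qed.

Lemma weight_geB n al be :
  weight_ge n al -> weight_ge n be -> weight_ge n (al - be).
Proof. by move=> al_ge be_ge; apply/weight_geD/weight_geN. Qed.

Let val4_1 : val4_ge p 0 1.
Proof. by apply/val4_ge_loc => //; exact: (Zloc_int p_pr 1). Qed.

Let val4_0 e : val4_ge p e 0. Proof. exact: val4_ge0. Qed.

Lemma weight_ge_1 : weight_ge 0 1.
Proof. by exists 1, 0, 0, 0; split=> //; rewrite /lincomb4; ring. Qed.

Lemma weight_ge_0 n : weight_ge n 0.
Proof. by exists 0, 0, 0, 0; split=> //; rewrite /lincomb4; ring. Qed.

Lemma weight_ge_rat n r : val4_ge p n r -> weight_ge n (ratr r).
Proof. by exists r, 0, 0, 0; split=> //; rewrite /lincomb4; ring. Qed.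

Lemma weight_ge_theta : weight_ge 2 theta.
Proof. by exists 0, 1, 0, 0; split=> //; rewrite /lincomb4; ring. Qed.

Lemma weight_ge_Phi : weight_ge h Phi.
Proof.
by exists 0, 0, 1, 0; split=> //; rewrite ?subrr // /lincomb4; ring.
Qed.

Lemma weight_ge_thetaPhi : weight_ge (h + 2) (theta * Phi).
Proof.
exists 0, 0, 0, 1; split=> //; last by rewrite /lincomb4; ring.
by apply: val4_ge_le val4_1 _; lia.
Qed.

(** The leading term of [theta ^+ 2] is [y * p]. *)
Lemma weight_ge_sqr_theta : weight_ge 5 (theta ^+ 2 - ratr (y * p%:R)).
Proof.
rewrite sqr_theta (_ : _ - _ = ratr g0 + ratr g1 * theta + Phi); last by ring.
apply: weight_geD; last by apply: weight_ge_le weight_ge_Phi _; lia.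
apply: weight_geD; first exact: weight_ge_rat.
by apply: weight_geZ_le g1_ge weight_ge_theta _.
Qed.

Let val4_p : val4_ge p 4 p%:R. Proof. exact: (val4_ge_ppow p_pr 1). Qed.

Let val4_yp : val4_ge p 4 (y * p%:R).
Proof. by rewrite -[4]add0r; apply: val4_geM => //; apply/val4_ge_loc. Qed.

Lemma weight_ge_theta2 : weight_ge 4 (theta ^+ 2).
Proof.
rewrite -[_ ^+ 2](subrK (ratr (y * p%:R))).
apply: weight_geD; last exact: weight_ge_rat.
exact: weight_ge_le weight_ge_sqr_theta _.
Qed.

Lemma weight_ge_Phi2 : weight_ge (2 * h) (Phi ^+ 2).
Proof.
exists n0, m0, n1, m1; split=> //.
  by apply: val4_ge_le n1_ge _; lia.
by apply: val4_ge_le m1_ge _; lia.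
Qed.

Let weight_ge_theta2Phi : weight_ge (h + 4) (theta ^+ 2 * Phi).
Proof.
have -> : theta ^+ 2 * Phi
  = ratr (y * p%:R + g0) * Phi + ratr g1 * (theta * Phi) + Phi ^+ 2.
  by rewrite sqr_theta; ring.
apply: weight_geD; last by apply: weight_ge_le weight_ge_Phi2 _; lia.
apply: weight_geD; last by apply: weight_geZ_le g1_ge weight_ge_thetaPhi _; lia.
apply: (@weight_geZ_le 4 h) => //; [|exact: weight_ge_Phi|lia].
by apply: val4_geD => //; apply: val4_ge_le g0_ge _.
Qed.

Lemma weight_ge_mul_theta n al :
  weight_ge n al -> weight_ge (n + 2) (theta * al).
Proof.
case=> a [b [c [d [ha hb hc hd ->]]]].
have -> : theta * lincomb4 a b c d = ratr a * theta + ratr b * theta ^+ 2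
    + (ratr c * (theta * Phi) + ratr d * (theta ^+ 2 * Phi)).
  by rewrite /lincomb4; ring.
do !apply: weight_geD.
- exact: weight_geZ weight_ge_theta.
- by apply: weight_geZ_le hb weight_ge_theta2 _; lia.
- by apply: weight_geZ_le hc weight_ge_thetaPhi _; lia.
- by apply: weight_geZ_le hd weight_ge_theta2Phi _; lia.
Qed.

Lemma weight_ge_mul_Phi n al :
  weight_ge n al -> weight_ge (n + h) (Phi * al).
Proof.
case=> a [b [c [d [ha hb hc hd ->]]]].
have -> : Phi * lincomb4 a b c d = ratr a * Phi + ratr b * (theta * Phi)
    + (ratr c * Phi ^+ 2 + ratr d * (theta * Phi ^+ 2)).
  by rewrite /lincomb4; ring.
do !apply: weight_geD.
- exact: weight_geZ weight_ge_Phi.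
- by apply: weight_geZ_le hb weight_ge_thetaPhi _; lia.
- by apply: weight_geZ_le hc weight_ge_Phi2 _; lia.
- by apply: weight_geZ_le hd (weight_ge_mul_theta weight_ge_Phi2) _; lia.
Qed.

(** It is enough to multiply by [theta] and by [Phi], which comes down to the two
    quadratic relations. *)
Lemma weight_geM n m al be :
  weight_ge n al -> weight_ge m be -> weight_ge (n + m) (al * be).
Proof.
case=> a [b [c [d [ha hb hc hd ->]]]] be_ge.
have -> : lincomb4 a b c d * be = ratr a * be + ratr b * (theta * be)
    + (ratr c * (Phi * be) + ratr d * (theta * (Phi * be))).
  by rewrite /lincomb4; ring.
have tbe := weight_ge_mul_theta be_ge; have Pbe := weight_ge_mul_Phi be_ge.
have tPbe := weight_ge_mul_theta Pbe.
do !apply: weight_geD.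
- exact: weight_geZ.
- by apply: weight_geZ_le hb tbe _; lia.
- by apply: weight_geZ_le hc Pbe _; lia.
- by apply: weight_geZ_le hd tPbe _; lia.
Qed.

Lemma weight_geX n al k :
  weight_ge n al -> weight_ge (n * k%:Z) (al ^+ k).
Proof.
move=> al_ge; elim: k => [|k IHk]; first by rewrite mulr0; exact: weight_ge_1.
by rewrite exprS (_ : n * k.+1%:Z = n + n * k%:Z); [apply: weight_geM | lia].
Qed.

(** The coordinates being unique, weights can also be bounded from above. *)
Lemma weight_ge_lincomb4 n a b c d : weight_ge n (lincomb4 a b c d) ->
  [/\ val4_ge p n a, val4_ge p (n - 2) b, val4_ge p (n - h) c
    & val4_ge p (n - h - 2) d].
Proof.
case=> a' [b' [c' [d' [ha hb hc hd /eqP]]]]; rewrite -subr_eq0 => /eqP eq0.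
have [] := @free4 (a - a') (b - b') (c - c') (d - d').
  by rewrite -[RHS]eq0 /lincomb4; ring.
by do 4![move/(canRL (subrK _)); rewrite add0r => ->].
Qed.

Lemma weight_ge_cancel e n r al :
  r != 0 -> val4_ge p (- e) r^-1 -> weight_ge (n + e) (ratr r * al) ->
  weight_ge n al.
Proof.
move=> r_neq0 rV_ge ral_ge.
have -> : al = ratr r^-1 * (ratr r * al).
  by rewrite mulrA -rmorphM /= mulVf // rmorph1 mul1r.
by apply: weight_geZ_le rV_ge ral_ge _; lia.
Qed.

(** Up to a unit [theta ^+ 2] is [p], so multiplication by [theta] moves the
    filtration by exactly two steps. *)
Lemma weight_ge_div_theta n al :
  weight_ge n al -> weight_ge (n + 3) (theta * al) -> weight_ge (n + 1) al.
Proof.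
move=> al_ge tal_ge.
apply: (@weight_ge_cancel 4 _ (y * p%:R)); first by rewrite mulf_neq0.
  rewrite invfM -[- 4]add0r; apply: val4_geM => //; first exact/val4_ge_loc.
  exact: (val4_ge_ppow p_pr (-1)).
have -> : ratr (y * p%:R) * al
    = theta * (theta * al) - (theta ^+ 2 - ratr (y * p%:R)) * al by ring.
apply: weight_geB.
  by apply: weight_ge_le (weight_ge_mul_theta tal_ge) _; lia.
by apply: weight_ge_le (weight_geM weight_ge_sqr_theta al_ge) _; lia.
Qed.

(** In degree [n] of the associated graded ring, only 0 has square 0. *)
Definition sqr_strict (n : int) : Prop := forall al,
  weight_ge n al -> weight_ge (2 * n + 1) (al ^+ 2) -> weight_ge (n + 1) al.

Lemma sqr_strict_sub2 n : sqr_strict n -> sqr_strict (n - 2).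
Proof.
move=> strict_n al al_ge al2_ge.
have tal_ge := weight_ge_mul_theta al_ge; rewrite subrK in tal_ge.
apply: weight_ge_le (weight_ge_div_theta al_ge _) _; last by [].
apply: weight_ge_le (strict_n _ tal_ge _) _; last by lia.
rewrite exprMn; apply: weight_ge_le (weight_geM weight_ge_theta2 al2_ge) _; lia.
Qed.

Lemma sqr_strict_add4 n : sqr_strict n -> sqr_strict (n + 4).
Proof.
move=> strict_n al al_ge al2_ge.
have pV_ge : val4_ge p (- 4) p%:R^-1 by exact: (val4_ge_ppow p_pr (-1)).
have pV_neq0 : p%:R^-1 != 0 :> rat by rewrite invr_eq0.
apply: (@weight_ge_cancel (- 4) _ p%:R^-1) => //; first by rewrite invrK opprK.
rewrite (_ : n + 4 + 1 + - 4 = n + 1); last by lia.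
apply: strict_n; first by apply: weight_geZ_le pV_ge al_ge _; lia.
rewrite exprMn expr2 -rmorphM /=.
by apply: weight_geZ_le (val4_geM p_pr pV_ge pV_ge) al2_ge _; lia.
Qed.

(** Multiplication by [theta] and by [p] shifts the degrees by 2 and 4, and both
    are invertible in the graded ring. *)
Lemma sqr_strict_parity n : sqr_strict 0 -> sqr_strict 1 -> sqr_strict n.
Proof.
move=> strict0 strict1.
have up i k : sqr_strict i -> sqr_strict (i + 4 * k%:Z).
  elim: k => [|k IHk] strict_i; first by rewrite mulr0 addr0.
  rewrite (_ : _ + _ = i + 4 * k%:Z + 4); last by lia.
  exact/sqr_strict_add4/IHk.
have down i k : sqr_strict i -> sqr_strict (i - 2 * k%:Z).
  elim: k => [|k IHk] strict_i; first by rewrite mulr0 subr0.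
  rewrite (_ : _ - _ = i - 2 * k%:Z - 2); last by lia.
  exact/sqr_strict_sub2/IHk.
have reach i q : sqr_strict i -> sqr_strict (i + 2 * q).
  move=> strict_i; have [a [b ->]] :
      exists a b : nat, i + 2 * q = i + 4 * a%:Z - 2 * b%:Z.
    by case: q => q; [exists q, q | exists 0%N, q.+1]; lia.
  exact/down/up.
have [[_ ->] | [_ ->]] := modz2P n; first by rewrite -[2 * _]add0r; apply: reach.
by rewrite addrC; apply: reach.
Qed.


Let Zloc_pV : p%:R^-1 \notin Zloc p.
Proof.
by rewrite -[_^-1]mul1r -ratr_Fp_eq0 ?(Zloc_int p_pr 1) // (ratr_int _ 1) oner_eq0.
Qed.

Let Zloc_sqr c : c \in Zloc p -> c ^+ 2 / p%:R \in Zloc p -> c / p%:R \in Zloc p.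
Proof.
move=> c_loc c2_loc; apply: contraNT Zloc_pV => c_unit.
have cV_loc := Zloc_inv p_pr c_loc c_unit.
have c_neq0 : c != 0.
  by apply: contraNneq c_unit => ->; rewrite mul0r (Zloc_int p_pr 0).
have -> : p%:R^-1 = c ^+ 2 / p%:R * c^-1 ^+ 2 by field; apply/andP.
by rewrite ZlocM // ZlocX.
Qed.

(** The degree [n] of the graded ring is a line generated by [T], and [S] is a
    leading term of [T ^+ 2] which is not 0 in degree [2 * n]. *)
Lemma sqr_strict_line n T S :
  weight_ge n T -> weight_ge (2 * n + 1) (T ^+ 2 - S) ->
  (forall al, weight_ge n al ->
     exists2 c, c \in Zloc p & weight_ge (n + 1) (al - ratr c * T)) ->
  (forall c, weight_ge (2 * n + 1) (ratr c * S) -> c / p%:R \in Zloc p) ->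
  sqr_strict n.
Proof.
move=> T_ge T2_ge lead indep al al_ge al2_ge.
have [c c_loc ep_ge] := lead al al_ge.
have /val4_ge_loc c_ge := c_loc; move: (c_ge p_pr) => {}c_ge.
have cT_ge : weight_ge n (ratr c * T) by apply: weight_geZ_le c_ge T_ge _; lia.
suff /indep/(Zloc_sqr c_loc) c_dvd : weight_ge (2 * n + 1) (ratr (c ^+ 2) * S).
  rewrite -[al](subrK (ratr c * T)); apply: weight_geD => //.
  by apply: (@weight_geZ_le 1 n) => //; [apply/(val4_ge_divp p_pr) | lia].
have -> : ratr (c ^+ 2) * S = al ^+ 2 - (al - ratr c * T) * (al + ratr c * T)
    - ratr (c ^+ 2) * (T ^+ 2 - S) by ring.
apply: weight_geB; first apply: weight_geB => //.
  by apply: weight_ge_le (weight_geM ep_ge (weight_geD al_ge cT_ge)) _; lia.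
by apply: weight_geZ_le (val4_geM p_pr c_ge c_ge) T2_ge _; lia.
Qed.

(** The degree 0 of the graded ring is ['F_p[T] / (T ^ 2 - C1 T - C0)]. If the
    class of [c + c' * T] has square 0, then [c' = 0] implies [c = 0], and
    otherwise [- c / c'] is a double root of the modulus. *)
Lemma sqr_strict_plane T C0 C1 :
  C0 \in Zloc p -> C1 \in Zloc p ->
  weight_ge 0 T -> weight_ge 1 (T ^+ 2 - (ratr C1 * T + ratr C0)) ->
  (forall al, weight_ge 0 al -> exists c c', [/\ c \in Zloc p, c' \in Zloc p &
     weight_ge 1 (al - (ratr c + ratr c' * T))]) ->
  (forall c c', weight_ge 1 (ratr c + ratr c' * T) ->
     c / p%:R \in Zloc p /\ c' / p%:R \in Zloc p) ->
  residually_separable p C0 C1 -> sqr_strict 0.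
Proof.
move=> C0_loc C1_loc T_ge T2_ge lead indep sep al al_ge.
rewrite mulr0 add0r => al2_ge.
have [c [c' [c_loc c'_loc ep_ge]]] := lead al al_ge.
have c_ge : val4_ge p 0 c by apply/val4_ge_loc.
have c'_ge : val4_ge p 0 c' by apply/val4_ge_loc.
set be := ratr c + ratr c' * T in ep_ge *.
have be_ge : weight_ge 0 be.
  by apply: weight_geD; [apply: weight_ge_rat | exact: weight_geZ_le c'_ge T_ge _].
have be2_ge : weight_ge 1 (ratr (c ^+ 2 + c' ^+ 2 * C0)
                           + ratr (2 * c * c' + c' ^+ 2 * C1) * T).
  have -> : ratr (c ^+ 2 + c' ^+ 2 * C0) + ratr (2 * c * c' + c' ^+ 2 * C1) * T
      = al ^+ 2 - (al - be) * (al + be)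
        - ratr (c' ^+ 2) * (T ^+ 2 - (ratr C1 * T + ratr C0)) by rewrite /be; ring.
  apply: weight_geB; first apply: weight_geB => //.
    by apply: weight_ge_le (weight_geM ep_ge (weight_geD al_ge be_ge)) _.
  by apply: weight_geZ_le (val4_geM p_pr c'_ge c'_ge) T2_ge _.
have {be2_ge} [dvd0 dvd1] := indep _ _ be2_ge.
suff [c_dvd c'_dvd] : c / p%:R \in Zloc p /\ c' / p%:R \in Zloc p.
  rewrite -[al](subrK be); apply: weight_geD => //; apply: weight_geD.
    by apply: weight_ge_rat; apply/(val4_ge_divp p_pr).
  by apply: (@weight_geZ_le 1 0) => //; apply/(val4_ge_divp p_pr).
have [c'_dvd | c'_unit] := boolP (c' / p%:R \in Zloc p).
  split=> //; apply: Zloc_sqr => //.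
  have -> : c ^+ 2 / p%:R = (c ^+ 2 + c' ^+ 2 * C0) / p%:R - c' / p%:R * (c' * C0).
    by field.
  by apply: ZlocB => //; do !apply: ZlocM => //.
have c'V_loc := Zloc_inv p_pr c'_loc c'_unit.
have c'_neq0 : c' != 0.
  by apply: contraNneq c'_unit => ->; rewrite mul0r (Zloc_int p_pr 0).
case: (sep (c / c')); first exact: ZlocM.
  have -> : ((c / c') ^+ 2 + C0) / p%:R
      = (c ^+ 2 + c' ^+ 2 * C0) / p%:R * c'^-1 ^+ 2 by field; apply/andP.
  by rewrite ZlocM // ZlocX.
have -> : (2 * (c / c') + C1) / p%:R
    = (2 * c * c' + c' ^+ 2 * C1) / p%:R * c'^-1 ^+ 2 by field; apply/andP.
by rewrite ZlocM // ZlocX.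
Qed.

Let yp_neq0 : y * p%:R != 0. Proof. by rewrite mulf_neq0. Qed.

Let val4_ypz (k : int) : val4_ge p (4 * k) ((y * p%:R) ^ k).
Proof. exact: val4_ge_unitz. Qed.

(** Among [Phi] and [theta * Phi] exactly one, [Phi] here, has a weight divisible
    by 4, and dividing it by a power of [y * p] gives the generator [T]. The
    choice of [y * p] instead of [p] matches [theta ^ 2 = y * p] in the graded
    ring, hence the residual coefficients. *)
Lemma sqr_strict0_mod0 (m : int) : h = 4 * m ->
  residually_separable p (n0 / (y * p%:R) ^ (2 * m)) (n1 / (y * p%:R) ^ m) ->
  sqr_strict 0.
Proof.
move=> def_h; set q := ((y * p%:R) ^ m)^-1.
have q_neq0 : q != 0 by rewrite invr_eq0 expfz_neq0.
have q_ge : val4_ge p (- (4 * m)) q.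
  by rewrite /q invr_expz -mulrN; apply: val4_ypz.
have qV_ge : val4_ge p (4 * m) q^-1 by rewrite invrK; apply: val4_ypz.
have -> : ((y * p%:R) ^ (2 * m))^-1 = q ^+ 2.
  by rewrite [2 * m]mulrC -exprz_exp exprVn.
have q2_ge := val4_geM p_pr q_ge q_ge; rewrite -expr2 in q2_ge.
move=> sep.
apply: (sqr_strict_plane (T := ratr q * Phi) _ _ _ _ _ _ sep).
- apply/val4_ge_loc => //.
  by apply: val4_ge_le (val4_geM p_pr n0_ge q2_ge) _; lia.
- by apply/val4_ge_loc => //; apply: val4_ge_le (val4_geM p_pr n1_ge q_ge) _; lia.
- by apply: weight_geZ_le q_ge weight_ge_Phi _; lia.
- have -> : (ratr q * Phi) ^+ 2
      - (ratr (n1 * q) * (ratr q * Phi) + ratr (n0 * q ^+ 2))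
      = ratr (q ^+ 2 * m0) * theta + ratr (q ^+ 2 * m1) * (theta * Phi).
    by rewrite exprMn sqr_Phi; ring.
  apply: weight_geD.
    have m0_ge' : val4_ge p (8 * m) m0.
      by apply: (@val4_ge_round _ p_pr (2 * m - 1) _ _ _ m0_ge); lia.
    by apply: weight_geZ_le (val4_geM p_pr q2_ge m0_ge') weight_ge_theta _; lia.
  have m1_ge' : val4_ge p (4 * m) m1.
    by apply: (@val4_ge_round _ p_pr (m - 1) _ _ _ m1_ge); lia.
  by apply: weight_geZ_le (val4_geM p_pr q2_ge m1_ge') weight_ge_thetaPhi _; lia.
- move=> al [a [b [c [d [ha hb hc hd ->]]]]]; exists a, (c / q); split.
  + exact/val4_ge_loc.
  + by apply/val4_ge_loc => //; apply: val4_ge_le (val4_geM p_pr hc qV_ge) _; lia.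
  have -> : lincomb4 a b c d - (ratr a + ratr (c / q) * (ratr q * Phi))
      = ratr b * theta + ratr d * (theta * Phi).
    by rewrite /lincomb4 mulrA -rmorphM /= divfK //; ring.
  apply: weight_geD.
    apply: (@weight_geZ_le 0 2) => //; last exact: weight_ge_theta.
    by apply: (@val4_ge_round _ p_pr (-1) _ _ _ hb).
  apply: (@weight_geZ_le (- (4 * m)) (h + 2)); [|exact: weight_ge_thetaPhi|lia].
  by apply: (@val4_ge_round _ p_pr (- m - 1) _ _ _ hd); lia.
move=> c c'; have -> : ratr c + ratr c' * (ratr q * Phi) = lincomb4 c 0 (c' * q) 0.
  by rewrite /lincomb4; ring.
case/weight_ge_lincomb4 => c_ge _ c'_ge _; split; first exact/(val4_ge_divp p_pr (e := 1)).
apply/(val4_ge_divp p_pr (e := 1)) => //; rewrite -[c'](mulfK q_neq0).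
by apply: val4_ge_le (val4_geM p_pr c'_ge qV_ge) _; lia.
Qed.

(** Here the generator comes from [theta * Phi]. The coefficient of [T] in
    [T ^+ 2] is then, up to a power of [y * p], the class of
    [theta * (n1 + m1 * theta)], to which only [m1 * theta ^ 2] contributes. *)
Lemma sqr_strict0_mod2 (m : int) : h = 4 * m - 2 ->
  residually_separable p (n0 / (y * p%:R) ^ (2 * m - 1))
                       (m1 / (y * p%:R) ^ (m - 1)) ->
  sqr_strict 0.
Proof.
move=> def_h; set q := ((y * p%:R) ^ m)^-1; set yp := y * p%:R.
have q_neq0 : q != 0 by rewrite invr_eq0 expfz_neq0.
have q_ge : val4_ge p (- (4 * m)) q.
  by rewrite /q invr_expz -mulrN; apply: val4_ypz.
have qV_ge : val4_ge p (4 * m) q^-1 by rewrite invrK; apply: val4_ypz.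
have -> : (yp ^ (2 * m - 1))^-1 = yp * q ^+ 2.
  by rewrite expfzDr // [2 * m]mulrC -exprz_exp exprN1 invfM invrK mulrC exprVn.
have -> : (yp ^ (m - 1))^-1 = yp * q.
  by rewrite expfzDr // exprN1 invfM invrK mulrC.
have q2_ge := val4_geM p_pr q_ge q_ge; rewrite -expr2 in q2_ge.
have yq2_ge := val4_geM p_pr val4_yp q2_ge; have yq_ge := val4_geM p_pr val4_yp q_ge.
move=> sep.
apply: (sqr_strict_plane (T := ratr q * (theta * Phi)) _ _ _ _ _ _ sep).
- apply/val4_ge_loc => //.
  by apply: val4_ge_le (val4_geM p_pr n0_ge yq2_ge) _; lia.
- apply/val4_ge_loc => //.
  by apply: val4_ge_le (val4_geM p_pr m1_ge yq_ge) _; lia.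
- by apply: weight_geZ_le q_ge weight_ge_thetaPhi _; lia.
- have -> : (ratr q * (theta * Phi)) ^+ 2
      - (ratr (m1 * (yp * q)) * (ratr q * (theta * Phi)) + ratr (n0 * (yp * q ^+ 2)))
      = ratr (q ^+ 2) * ((theta ^+ 2 - ratr yp) * Phi ^+ 2)
        + (ratr (yp * q ^+ 2 * m0) * theta + ratr (yp * q ^+ 2 * n1) * Phi).
    by rewrite mulrBl (exprMn 2 (ratr q)) (exprMn 2 theta) sqr_Phi; ring.
  apply: weight_geD.
    by apply: weight_geZ_le q2_ge (weight_geM weight_ge_sqr_theta weight_ge_Phi2) _; lia.
  apply: weight_geD.
    have m0_ge' : val4_ge p (4 * (2 * m - 1)) m0.
      by apply: (@val4_ge_round _ p_pr (2 * m - 2) _ _ _ m0_ge); lia.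
    by apply: weight_geZ_le (val4_geM p_pr yq2_ge m0_ge') weight_ge_theta _; lia.
  have n1_ge' : val4_ge p (4 * m) n1.
    by apply: (@val4_ge_round _ p_pr (m - 1) _ _ _ n1_ge); lia.
  by apply: weight_geZ_le (val4_geM p_pr yq2_ge n1_ge') weight_ge_Phi _; lia.
- move=> al [a [b [c [d [ha hb hc hd ->]]]]]; exists a, (d / q); split.
  + exact/val4_ge_loc.
  + by apply/val4_ge_loc => //; apply: val4_ge_le (val4_geM p_pr hd qV_ge) _; lia.
  have -> : lincomb4 a b c d - (ratr a + ratr (d / q) * (ratr q * (theta * Phi)))
      = ratr b * theta + ratr c * Phi.
    by rewrite /lincomb4 mulrA -rmorphM /= divfK //; ring.
  apply: weight_geD.
    apply: (@weight_geZ_le 0 2) => //; last exact: weight_ge_theta.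
    by apply: (@val4_ge_round _ p_pr (-1) _ _ _ hb).
  apply: (@weight_geZ_le (4 - 4 * m) h); [|exact: weight_ge_Phi|lia].
  by apply: (@val4_ge_round _ p_pr (- m) _ _ _ hc); lia.
move=> c c'.
have -> : ratr c + ratr c' * (ratr q * (theta * Phi)) = lincomb4 c 0 0 (c' * q).
  by rewrite /lincomb4; ring.
case/weight_ge_lincomb4 => c_ge _ _ c'_ge; split; first exact/(val4_ge_divp p_pr (e := 1)).
apply/(val4_ge_divp p_pr (e := 1)) => //; rewrite -[c'](mulfK q_neq0).
by apply: val4_ge_le (val4_geM p_pr c'_ge qV_ge) _; lia.
Qed.

Let val4_ge_odd (j e e' : int) c : val4_ge p e c ->
  e = 2 * j + 1 -> e' = e + 1 -> val4_ge p e' c.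
Proof. by case=> k le_ek c_loc def_e ->; exists k => //; lia. Qed.

(** For even [h] all weights are even: the degree 1 is zero. *)
Lemma sqr_strict1_even (s : int) : h = 2 * s -> sqr_strict 1.
Proof.
move=> def_h al [a [b [c [d [ha hb hc hd ->]]]]] _; exists a, b, c, d; split=> //.
- exact: (val4_ge_odd (j := 0) ha).
- exact: (val4_ge_odd (j := -1) hb).
- by apply: (val4_ge_odd (j := - s) hc); lia.
- by apply: (val4_ge_odd (j := - s - 1) hd); lia.
Qed.

(** For odd [h] the basis elements [Phi] and [theta * Phi] have odd weights, so
    the degree 0 consists of the residue field alone. *)
Lemma sqr_strict0_odd (j : int) : h = 2 * j + 1 -> sqr_strict 0.
Proof.
move=> def_h; apply: (@sqr_strict_line 0 1 1).
- exact: weight_ge_1.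
- by rewrite expr1n subrr; exact: weight_ge_0.
- move=> al [a [b [c [d [ha hb hc hd ->]]]]]; exists a; first exact/val4_ge_loc.
  exists 0, b, c, d; split=> //; last by rewrite /lincomb4; ring.
  + by case: hb => k le_k b_loc; exists k => //; lia.
  + by apply: (val4_ge_odd (j := - j - 1) hc); lia.
  + by apply: (val4_ge_odd (j := - j - 2) hd); lia.
move=> c; rewrite (_ : ratr c * 1 = lincomb4 c 0 0 0); last by rewrite /lincomb4; ring.
by case/weight_ge_lincomb4 => c_ge _ _ _; apply/(val4_ge_divp p_pr (e := 1)).
Qed.

Let sqr_strict1_theta T W : W \in Zloc p -> W / p%:R \notin Zloc p ->
  weight_ge 1 T -> weight_ge 3 (T ^+ 2 - ratr W * theta) ->
  (forall al, weight_ge 1 al ->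
     exists2 c, c \in Zloc p & weight_ge 2 (al - ratr c * T)) ->
  sqr_strict 1.
Proof.
move=> W_loc W_unit T_ge T2_ge lead.
apply: (sqr_strict_line T_ge T2_ge) => // c.
have -> : ratr c * (ratr W * theta) = lincomb4 0 (c * W) 0 0.
  by rewrite /lincomb4; ring.
case/weight_ge_lincomb4 => _ /(val4_ge_divp p_pr (e := 1) _ isT isT) cW_dvd _ _.
have W_neq0 : W != 0.
  by apply: contraNneq W_unit => ->; rewrite mul0r (Zloc_int p_pr 0).
have -> : c / p%:R = c * W / p%:R * W^-1 by field; apply/andP.
by apply: ZlocM => //; apply: Zloc_inv W_unit.
Qed.

(** For odd [h] the degree 1 is generated by [Phi] or [theta * Phi], up to a
    power of [y * p]. Among the four terms of [Phi ^+ 2] only [m0 * theta] can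
    have weight [2 * h], since valuations of coefficients are integers; it is
    the leading term. *)
Lemma sqr_strict1_mod1 (m : int) : h = 4 * m + 1 ->
  ~ val4_ge p (2 * h - 1) m0 -> sqr_strict 1.
Proof.
move=> def_h m0_exact; set q := ((y * p%:R) ^ m)^-1.
have q_neq0 : q != 0 by rewrite invr_eq0 expfz_neq0.
have q_ge : val4_ge p (- (4 * m)) q.
  by rewrite /q invr_expz -mulrN; apply: val4_ypz.
have qV_ge : val4_ge p (4 * m) q^-1 by rewrite invrK; apply: val4_ypz.
have q2_ge := val4_geM p_pr q_ge q_ge; rewrite -expr2 in q2_ge.
have qV2_ge := val4_geM p_pr qV_ge qV_ge; rewrite -expr2 in qV2_ge.
apply: (@sqr_strict1_theta (ratr q * Phi) (q ^+ 2 * m0)).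
- by apply/val4_ge_loc => //; apply: val4_ge_le (val4_geM p_pr q2_ge m0_ge) _; lia.
- apply/negP => /(val4_ge_divp p_pr (e := 4) _ isT isT) W_ge; apply: m0_exact.
  have -> : m0 = q ^+ 2 * m0 * q^-1 ^+ 2 by field.
  by apply: val4_ge_le (val4_geM p_pr W_ge qV2_ge) _; lia.
- by apply: weight_geZ_le q_ge weight_ge_Phi _; lia.
- have -> : (ratr q * Phi) ^+ 2 - ratr (q ^+ 2 * m0) * theta
      = ratr (q ^+ 2 * n0)
        + (ratr (q ^+ 2 * n1) * Phi + ratr (q ^+ 2 * m1) * (theta * Phi)).
    by rewrite exprMn sqr_Phi; ring.
  apply: weight_geD; last apply: weight_geD.
  + apply: weight_ge_rat; have n0_ge' : val4_ge p (8 * m + 4) n0.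
      by apply: (@val4_ge_round _ p_pr (2 * m) _ _ _ n0_ge); lia.
    by apply: val4_ge_le (val4_geM p_pr q2_ge n0_ge') _; lia.
  + have n1_ge' : val4_ge p (4 * m + 4) n1.
      by apply: (@val4_ge_round _ p_pr m _ _ _ n1_ge); lia.
    by apply: weight_geZ_le (val4_geM p_pr q2_ge n1_ge') weight_ge_Phi _; lia.
  + have m1_ge' : val4_ge p (4 * m) m1.
      by apply: (@val4_ge_round _ p_pr (m - 1) _ _ _ m1_ge); lia.
    by apply: weight_geZ_le (val4_geM p_pr q2_ge m1_ge') weight_ge_thetaPhi _; lia.
move=> al [a [b [c [d [ha hb hc hd ->]]]]]; exists (c / q).
  by apply/val4_ge_loc => //; apply: val4_ge_le (val4_geM p_pr hc qV_ge) _; lia.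
exists a, b, 0, d; split=> //.
- exact: (val4_ge_odd (j := 0) ha).
- exact: (val4_ge_odd (j := -1) hb).
- by case: hd => k le_k d_loc; exists k => //; lia.
by rewrite /lincomb4 mulrA -rmorphM /= divfK //; ring.
Qed.

Lemma sqr_strict1_mod3 (m : int) : h = 4 * m - 1 ->
  ~ val4_ge p (2 * h - 1) m0 -> sqr_strict 1.
Proof.
move=> def_h m0_exact; set q := ((y * p%:R) ^ m)^-1; set yp := y * p%:R.
have q_neq0 : q != 0 by rewrite invr_eq0 expfz_neq0.
have q_ge : val4_ge p (- (4 * m)) q.
  by rewrite /q invr_expz -mulrN; apply: val4_ypz.
have qV_ge : val4_ge p (4 * m) q^-1 by rewrite invrK; apply: val4_ypz.
have q2_ge := val4_geM p_pr q_ge q_ge; rewrite -expr2 in q2_ge.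
have qV2_ge := val4_geM p_pr qV_ge qV_ge; rewrite -expr2 in qV2_ge.
have ypV_ge : val4_ge p (- 4) yp^-1 by exact: (val4_ypz (-1)).
have yq2_ge := val4_geM p_pr val4_yp q2_ge.
apply: (@sqr_strict1_theta (ratr q * (theta * Phi)) (yp * q ^+ 2 * m0)).
- by apply/val4_ge_loc => //; apply: val4_ge_le (val4_geM p_pr yq2_ge m0_ge) _; lia.
- apply/negP => /(val4_ge_divp p_pr (e := 4) _ isT isT) W_ge; apply: m0_exact.
  have -> : m0 = yp * q ^+ 2 * m0 * (yp^-1 * q^-1 ^+ 2) by field; apply/andP.
  apply: val4_ge_le (val4_geM p_pr W_ge (val4_geM p_pr ypV_ge qV2_ge)) _; lia.
- by apply: weight_geZ_le q_ge weight_ge_thetaPhi _; lia.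
- have -> : (ratr q * (theta * Phi)) ^+ 2 - ratr (yp * q ^+ 2 * m0) * theta
      = ratr (q ^+ 2) * ((theta ^+ 2 - ratr yp) * Phi ^+ 2)
        + (ratr (yp * q ^+ 2 * n0)
           + (ratr (yp * q ^+ 2 * n1) * Phi
              + ratr (yp * q ^+ 2 * m1) * (theta * Phi))).
    by rewrite mulrBl (exprMn 2 (ratr q)) (exprMn 2 theta) sqr_Phi; ring.
  apply: weight_geD; last apply: weight_geD; last apply: weight_geD.
  + by apply: weight_geZ_le q2_ge (weight_geM weight_ge_sqr_theta weight_ge_Phi2) _; lia.
  + apply: weight_ge_rat; have n0_ge' : val4_ge p (8 * m) n0.
      by apply: (@val4_ge_round _ p_pr (2 * m - 1) _ _ _ n0_ge); lia.
    by apply: val4_ge_le (val4_geM p_pr yq2_ge n0_ge') _; lia.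
  + have n1_ge' : val4_ge p (4 * m) n1.
      by apply: (@val4_ge_round _ p_pr (m - 1) _ _ _ n1_ge); lia.
    by apply: weight_geZ_le (val4_geM p_pr yq2_ge n1_ge') weight_ge_Phi _; lia.
  + have m1_ge' : val4_ge p (4 * m) m1.
      by apply: (@val4_ge_round _ p_pr (m - 1) _ _ _ m1_ge); lia.
    by apply: weight_geZ_le (val4_geM p_pr yq2_ge m1_ge') weight_ge_thetaPhi _; lia.
move=> al [a [b [c [d [ha hb hc hd ->]]]]]; exists (d / q).
  by apply/val4_ge_loc => //; apply: val4_ge_le (val4_geM p_pr hd qV_ge) _; lia.
exists a, b, c, 0; split=> //.
- exact: (val4_ge_odd (j := 0) ha).
- exact: (val4_ge_odd (j := -1) hb).
- by case: hc => k le_k c_loc; exists k => //; lia.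
by rewrite /lincomb4 mulrA -rmorphM /= divfK //; ring.
Qed.

(** For odd [h] the second condition says that [m0 * theta] has weight exactly
    [2 * h]. *)
Definition regular_residue : Prop :=
  (forall s : int, h = 2 * s ->
     residually_separable p (n0 / (y * p%:R) ^ s)
       ((if (s %% 2)%Z == 0 then n1 else m1) / (y * p%:R) ^ (s %/ 2)%Z)) /\
  (forall s : int, h = 2 * s + 1 -> ~ val4_ge p (2 * h - 1) m0).

Lemma sqr_strict_regular n : regular_residue -> sqr_strict n.
Proof.
case=> reg_even reg_odd.
have [[_ def_h] | [_ def_h]] := modz2P h; move: (h %/ 2)%Z def_h => s def_h.
  apply: sqr_strict_parity (sqr_strict1_even def_h).
  have := reg_even s def_h; rewrite /residue_c1.
  have [[-> def_s] | [-> def_s]] := modz2P s; move: (s %/ 2)%Z def_s => m def_s /= sep.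
    by apply: (@sqr_strict0_mod0 m); [lia | rewrite -def_s].
  apply: (@sqr_strict0_mod2 (m + 1)); first by lia.
  by rewrite addrK -(_ : s = 2 * (m + 1) - 1) //; lia.
apply: sqr_strict_parity (sqr_strict0_odd def_h) _.
have m0_exact := reg_odd s def_h.
have [[_ def_s] | [_ def_s]] := modz2P s; move: (s %/ 2)%Z def_s => m def_s.
  by apply: (@sqr_strict1_mod1 m) => //; lia.
by apply: (@sqr_strict1_mod3 (m + 1)) => //; lia.
Qed.

Section Maximality.

Hypothesis strict : forall n, sqr_strict n.

(** Extract square roots [k] times. *)
Let weight_ge_descend n al k : weight_ge n al ->
  weight_ge (n * (2 ^ k)%N + 1) (al ^+ (2 ^ k)) -> weight_ge (n + 1) al.
Proof.
move=> al_ge; elim: k => [|k IHk]; first by rewrite mulr1.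
rewrite expnSr exprM => alk_ge; apply: IHk; apply: strict.
  exact: weight_geX.
by apply: weight_ge_le alk_ge _; lia.
Qed.

(** All powers are integral combinations of the first ones. *)
Let weight_ge_bounded n al : n <= 0 -> weight_ge n al -> al \in Aint ->
  exists B : int, forall k, weight_ge B (al ^+ k).
Proof.
move=> n_le0 al_ge al_int; set P := minCpoly al.
have [Pz def_P] : exists Pz : {poly int}, P = map_poly intr Pz.
  by move: al_int; rewrite unfold_in -/P => /floorpP[Pz ->]; exists Pz.
have := root_minCpoly al; rewrite -/P /root horner_coef.
have := size_minCpoly al; have := monicP (minCpoly_monic al); rewrite -/P.
rewrite lead_coefE; case: (size P) => // d /= Pd _.
rewrite big_ord_recr /= Pd mul1r addrC addr_eq0 => /eqP al_d.
exists (n * d%:Z) => k; elim/ltn_ind: k => k IHk.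
have [lt_kd | le_dk] := ltnP k d.
  by apply: weight_ge_le (weight_geX k al_ge) _; nia.
rewrite -(subnK le_dk) exprD al_d mulrN mulr_sumr; apply: weight_geN.
apply: (@big_ind _ (weight_ge (n * d%:Z))) => [|? ?|i _]; first exact: weight_ge_0.
  exact: weight_geD.
rewrite mulrCA -exprD def_P coef_map /= -(ratr_int _ Pz`_i).
apply: (@weight_geZ_le 0 (n * d%:Z)); last by rewrite add0r.
  by apply/val4_ge_loc => //; exact: Zloc_int.
by apply: IHk; rewrite -ltn_subRL subKn // ltn_ord.
Qed.

(** A negative weight would double with each squaring, against
    [weight_ge_bounded]. *)
Lemma weight_ge0_of_Aint n al : weight_ge n al -> al \in Aint -> weight_ge 0 al.
Proof.
move=> al_ge al_int; suff up k : weight_ge (- k%:Z) al -> weight_ge 0 al.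
  by apply: (up `|n|%N); apply: weight_ge_le al_ge _; lia.
elim: k => [|k IHk] {}al_ge; first by rewrite oppr0 in al_ge.
apply: IHk; rewrite (_ : - k%:Z = - k.+1%:Z + 1); last by lia.
have [B al_geB] : exists B : int, forall j, weight_ge B (al ^+ j).
  by apply: weight_ge_bounded al_ge al_int; lia.
(* the exponent only has to satisfy [1 - B <= 2 ^ k] *)
apply: (weight_ge_descend (k := `|B|.+1) al_ge).
apply: weight_ge_le (al_geB _) _.
have : (`|B|.+1 < 2 ^ `|B|.+1)%N by exact: ltn_expl.
by move: (2 ^ _)%N => N; nia.
Qed.

End Maximality.

Variables f f' : int.
Hypotheses (f_le : 4 * f <= h) (f_gt : h < 4 * f + 4).
Hypotheses (f'_le : 4 * f' <= h + 2) (f'_gt : h + 2 < 4 * f' + 4).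

Definition integral_tuple : 4.-tuple algC :=
  [tuple 1; theta; Phi / p%:R ^ f; theta * Phi / p%:R ^ f'].

Let ratr_pz (k : int) : ratr (p%:R ^ k) = p%:R ^ k :> algC.
Proof. by case: k => n; rewrite ?NegzE -?exprnN -?exprnP ?fmorphV rmorphXn /= ratr_nat. Qed.

Lemma integral_tuple_comb (c : 'rV[rat]_4) :
  \sum_(i < 4) ratr (c 0 i) * tnth integral_tuple i
  = lincomb4 (c 0 0) (c 0 1) (c 0 2%:R / p%:R ^ f) (c 0 3%:R / p%:R ^ f').
Proof.
rewrite !big_ord_recl big_ord0 !(tnth_nth 0) /= addr0.
have -> : lift ord0 ord0 = 1 :> 'I_4 by apply/val_inj.
have -> : lift ord0 (lift ord0 ord0) = 2%:R :> 'I_4 by apply/val_inj.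
have -> : lift ord0 (lift ord0 (lift ord0 ord0)) = 3%:R :> 'I_4 by apply/val_inj.
by rewrite /lincomb4 !fmorph_div /= !ratr_pz; ring.
Qed.

Lemma weight_ge0_coord al : weight_ge 0 al ->
  exists! c : 'rV[rat]_4, (forall i, c 0 i \in Zloc p) /\
     al = \sum_(i < 4) ratr (c 0 i) * tnth integral_tuple i.
Proof.
case=> a [b [c [d [ha hb hc hd ->]]]].
pose u : 'rV[rat]_4 := \row_i [:: a; b; c * p%:R ^ f; d * p%:R ^ f']`_i.
have pz_neq0 (k : int) : p%:R ^ k != 0 :> rat by rewrite expfz_neq0.
exists u; split=> [|v [_]].
  split; last by rewrite integral_tuple_comb !mxE /= !mulfK.
  have loc e r : -4 < e -> val4_ge p e r -> r \in Zloc p.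
    move=> e_gt r_ge; apply/val4_ge_loc => //.
    by apply: (@val4_ge_round _ p_pr (-1) _ _ _ r_ge); lia.
  case; case=> [|[|[|[|//]]]] lt_i; rewrite mxE /=.
  - exact: loc ha.
  - exact: loc hb.
  - by apply: loc (val4_geM p_pr hc (val4_ge_ppow p_pr f)); lia.
  - by apply: loc (val4_geM p_pr hd (val4_ge_ppow p_pr f')); lia.
rewrite integral_tuple_comb => /eqP; rewrite -subr_eq0 => /eqP eq0.
have [] := @free4 (a - v 0 0) (b - v 0 1) (c - v 0 2%:R / p%:R ^ f)
                  (d - v 0 3%:R / p%:R ^ f').
  by rewrite -[RHS]eq0 /lincomb4; ring.
rewrite /u; do 4![move/(canRL (subrK _)); rewrite add0r => ->].
apply/rowP; case; case=> [|[|[|[|//]]]] lt_i; rewrite mxE /= ?divfK //;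
  congr (v 0 _); exact/val_inj.
Qed.

Lemma weight_ge0_tnth i : weight_ge 0 (tnth integral_tuple i).
Proof.
rewrite (tnth_nth 0) /=.
have pz_ge (k e : int) : e <= - (4 * k) -> val4_ge p e (p%:R ^ k)^-1.
  by move=> le_e; apply: val4_ge_le le_e; rewrite invr_expz -mulrN; apply: val4_ge_ppow.
case: i => -[|[|[|[|//]]]] lt_i /=.
- exact: weight_ge_1.
- exact: weight_ge_le weight_ge_theta _.
- rewrite mulrC -ratr_pz -fmorphV /=.
  by apply: weight_geZ_le (pz_ge f _ (lexx _)) weight_ge_Phi _; lia.
rewrite mulrC -ratr_pz -fmorphV /=.
by apply: weight_geZ_le (pz_ge f' _ (lexx _)) weight_ge_thetaPhi _; lia.
Qed.

Variable K : algC -> Prop.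
Hypothesis K_lincomb4 : forall x, K x <-> exists a b c d, x = lincomb4 a b c d.

Let K_weight x : K x <-> exists n, weight_ge n x.
Proof.
split=> [/K_lincomb4[a [b [c [d ->]]]] | [n [a [b [c [d [_ _ _ _ def_x]]]]]]]; last first.
  by apply/K_lincomb4; exists a, b, c, d.
have bound r : exists e, val4_ge p e r.
  have [-> | r_neq0] := eqVneq r 0; first by exists 0.
  exists (4 * ((logn p `|numq r|)%:Z - (logn p `|denq r|)%:Z)).
  by apply/val4_ge_vp => //; rewrite /vp (negPf r_neq0).
have [e1 ha] := bound a; have [e2 hb] := bound b.
have [e3 hc] := bound c; have [e4 hd] := bound d.
pose n := - (`|e1| + `|e2| + `|e3| + `|e4|).
exists n, a, b, c, d; split=> //.
- by apply: val4_ge_le ha _; lia.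
- by apply: val4_ge_le hb _; lia.
- by apply: val4_ge_le hc _; lia.
- by apply: val4_ge_le hd _; lia.
Qed.

Theorem integral_tuple_basis :
  regular_residue -> p_integral_basis p K integral_tuple.
Proof.
move=> /sqr_strict_regular strict; split=> [i | x [a [m [Ka a_int pNm ->]]]].
  have [||m [pNm ai_int]] := @Aint_of_Zloc_module p p_pr 4 integral_tuple
                               (tnth integral_tuple i).
  - by exists 0; rewrite (tnth_nth 0) oner_eq0.
  - move=> j; have := weight_geM (weight_ge0_tnth i) (weight_ge0_tnth j).
    by rewrite addr0 => /weight_ge0_coord[c [[c_loc eq_c] _]]; exists (c 0).
  have m_neq0 : m%:R != 0 :> algC.
    by rewrite pnatr_eq0; apply: contraNneq pNm => ->; rewrite dvdn0.
  exists (tnth integral_tuple i * m%:R), m; split=> //; last by rewrite mulfK.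
  apply/K_weight; exists 0; rewrite mulrC -ratr_nat.
  apply: (@weight_geZ_le 0 0) => //; last exact: weight_ge0_tnth.
  by apply/val4_ge_loc => //; exact: Zloc_nat.
apply: weight_ge0_coord; have [n a_ge] := (K_weight a).1 Ka.
rewrite mulrC -ratr_nat -fmorphV /=.
apply: (@weight_geZ_le 0 0) => //; last exact: weight_ge0_of_Aint a_ge a_int.
by apply/val4_ge_loc => //; exact: Zloc_natV.
Qed.

End Filtration.

(** * The quartic field *)

Section QuarticField.

Variables (theta : algC) (G : {poly rat}) (u v : rat).
Hypotheses (G_irr : irreducible_poly G) (size_G : size G = 5%N).
Hypothesis G_theta : root (map_poly ratr G) theta.

Let ev (P : {poly rat}) : algC := (map_poly ratr P).[theta].

Let Phi := ev ('X^2 + u *: 'X + v%:P).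

Lemma root_irreducible_dvd (P : {poly rat}) : ev P = 0 -> G %| P.
Proof.
have [q [def_q _] q_dvd] := minCpolyP theta.
move=> /eqP P_theta; have q_P : q %| P by rewrite -q_dvd.
have q_G : q %| G by rewrite -q_dvd.
have /eqp_dvdl <- // : q %= G.
apply: G_irr.2 q_G; rewrite neq_ltn; apply/orP; right.
by have := size_minCpoly theta; rewrite def_q size_map_poly.
Qed.

Let lincomb4_ev a b c d : lincomb4 theta Phi a b c d
  = ev ((a + c * v)%:P + (b + c * u + d * v) *: 'X + (c + d * u) *: 'X^2 + d *: 'X^3).
Proof.
rewrite /lincomb4 /Phi /ev.
rewrite !rmorphD /= !map_polyZ !map_polyXn !map_polyX !map_polyC /=.
by rewrite !hornerD !hornerZ !hornerXn !hornerX !hornerC; ring.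
Qed.

Lemma quartic_free a b c d :
  lincomb4 theta Phi a b c d = 0 -> [/\ a = 0, b = 0, c = 0 & d = 0].
Proof.
rewrite lincomb4_ev; set P := _ + _ => /root_irreducible_dvd G_P.
have size_P : (size P <= 4)%N.
  apply/leq_sizeP => -[|[|[|[|i]]]] // _.
  by rewrite !(coefD, coefZ, coefXn, coefX, coefC) /= !mulr0 !addr0.
have P0 : P = 0.
  by apply/eqP; apply: contraTT G_P => P_neq0; rewrite gtNdvdp // size_G.
have coef0 i : P`_i = 0 by rewrite P0 coef0.
have := coef0 0%N; have := coef0 1%N; have := coef0 2%N; have := coef0 3%N.
rewrite !(coefD, coefZ, coefXn, coefX, coefC) /=.
rewrite !(mulr0, mulr1, addr0, add0r) => ->.
rewrite mul0r addr0 => ->.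
by rewrite !mul0r !addr0 => -> ->.
Qed.

(** The denominator is inverted modulo [G] by a Bezout relation. *)
Lemma Qadjoin_lincomb4 x :
  Qadjoin theta x <-> exists a b c d, x = lincomb4 theta Phi a b c d.
Proof.
split=> [[f [g [g_neq0 ->]]] | [a [b [c [d ->]]]]]; last first.
  rewrite lincomb4_ev; set P := _ + _; exists P, 1.
  by rewrite rmorph1 hornerC oner_eq0 divr1.
have /Bezout_eq1_coprimepP[[r s] /= rs1] : coprimep G g.
  rewrite irreducible_poly_coprime //; apply: contra g_neq0 => /dvdpP[w ->].
  by rewrite rmorphM hornerM (rootP G_theta) mulr0.
have gV : ev s * ev g = 1.
  have /(congr1 ev) := rs1; rewrite /ev rmorphD !rmorphM !hornerE /=.
  by rewrite (rootP G_theta) mulr0 add0r rmorph1 hornerC.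
have -> : (map_poly ratr f).[theta] / (map_poly ratr g).[theta] = ev (f * s).
  apply: (canLR (mulfK g_neq0)).
  by rewrite /ev rmorphM hornerM -mulrA [X in _ * X]gV mulr1.
set w := (f * s) %% G.
have -> : ev (f * s) = ev w.
  rewrite {1}(divp_eq (f * s) G) -/w /ev rmorphD rmorphM hornerD hornerM.
  by rewrite (rootP G_theta) mulr0 add0r.
have size_w : (size w <= 4)%N.
  by rewrite -ltnS -size_G ltn_modp -size_poly_eq0 size_G.
pose d := w`_3; pose c := w`_2 - d * u.
exists (w`_0 - c * v), (w`_1 - c * u - d * v), c, d.
rewrite lincomb4_ev; congr (ev _); apply/polyP => i.
rewrite !(coefD, coefZ, coefXn, coefX, coefC).
case: i => [|[|[|[|i]]]] /=; rewrite ?mulr0 ?mulr1 ?addr0 ?add0r //; try by rewrite /c; ring.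
by rewrite nth_default // (leq_trans size_w).
Qed.

End QuarticField.

(** * The second order Newton polygon *)

Lemma vp2_ge (p : nat) (p_pr : prime p) (e : int) (P : {poly rat}) :
  (e%:E <= vp2 p P)%E <-> forall i : nat, val4_ge p (2 * e - 2 * i%:Z) P`_i.
Proof.
have term c (i : nat) : (e%:E <= 2%:E * vp p c + (i%:Z)%:E)%E
    <-> val4_ge p (2 * e - 2 * i%:Z) c.
  have := val4_ge_vp p_pr _ c; rewrite /vp; case: eqVneq => [-> _ | _].
    by split=> _; [exact: val4_ge0 | rewrite mulry gtr0_sg // mul1e addye // leey].
  move: (_ - _ : int) => v vE; rewrite -EFinM -EFinD lee_fin; split=> [le_e | ].
    by apply: (@val4_ge_le _ (4 * v)); [apply/vE | lia].
  case=> k le_k c_loc; have /vE : val4_ge p (4 * k) c by exists k.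
  by rewrite lee_fin; lia.
split=> [/bigmin_geP[_ P_ge] i | P_ge]; last first.
  by apply/bigmin_geP; split=> [|i _]; [exact: leey | apply/term].
have [lt_i | le_i] := ltnP i (size P).
  by apply/term; exact: (P_ge (Ordinal lt_i)).
by rewrite nth_default //; exact: val4_ge0.
Qed.

Lemma vp2_fin (p : nat) (P : {poly rat}) :
  P != 0 -> exists V : int, vp2 p P = V%:E%E.
Proof.
move=> P_neq0.
have lt_size : ((size P).-1 < size P)%N by rewrite ltn_predL size_poly_gt0.
have fin_lead : (vp2 p P <= 2%:E * vp p (lead_coef P) + ((size P).-1%:Z)%:E)%E.
  by rewrite /vp2 lead_coefE; exact: (bigmin_le _ (Ordinal lt_size)
    (fun i : 'I_(size P) => 2%:E * vp p P`_i + (i%:Z)%:E)%E).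
have Nny : vp2 p P != -oo%E.
  rewrite /vp2; apply: (big_ind (fun x => x != -oo%E)) => // [x x' | i _].
    by rewrite /Order.min; case: ifP.
  by rewrite /vp; case: (eqVneq P`_i 0) => // _; rewrite mulry gtr0_sg // mul1e addye.
case: (vp2 p P) fin_lead Nny => // [V _ _ | ]; first by exists V.
rewrite /vp lead_coef_eq0 (negPf P_neq0) -EFinM -EFinD.
by rewrite leNgt ltry.
Qed.

Lemma vp2_zero p : vp2 p 0 = +oo%E.
Proof. by rewrite /vp2 size_poly0 big_ord0. Qed.

Lemma linear_polyE (P : {poly rat}) :
  (size P <= 2)%N -> P = (P`_0)%:P + P`_1 *: 'X.
Proof.
move=> size_P; apply/polyP => i; rewrite coefD coefZ coefX coefC.
case: i => [|[|i]] /=; rewrite ?mulr0 ?mulr1 ?addr0 ?add0r //.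
by rewrite nth_default // (leq_trans size_P).
Qed.

Section NewtonPolygon.

Variables (p : nat) (y z : rat) (A0 A1 : {poly rat}).
Hypothesis p_pr : prime p.
Hypotheses (y_neq0 : y != 0) (y_loc : y \in Zloc p) (yV_loc : y^-1 \in Zloc p).
Hypothesis z_loc : z \in Zloc p.
Hypotheses (A0_neq0 : A0 != 0) (size_A0 : (size A0 <= 2)%N).
Hypothesis size_A1 : (size A1 <= 2)%N.

Let n0 := A0`_0.
Let m0 := A0`_1.
Let n1 := A1`_0.
Let m1 := A1`_1.
Let phi : {poly rat} := 'X^2 + (z * p%:R) *: 'X - (y * p%:R)%:P.
Let pts := newton_points2 p phi [:: A0; A1; 1].

Let p_neq0 : p%:R != 0 :> rat.
Proof. by rewrite pnatr_eq0 -lt0n prime_gt0. Qed.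

Let val4_p : val4_ge p 4 p%:R. Proof. exact: (val4_ge_ppow p_pr 1). Qed.

Let val4_zp : val4_ge p 4 (z * p%:R).
Proof. by rewrite -[4]add0r; apply: val4_geM => //; apply/val4_ge_loc. Qed.

Let val4_yp : val4_ge p 4 (y * p%:R).
Proof. by rewrite -[4]add0r; apply: val4_geM => //; apply/val4_ge_loc. Qed.

Let val4_ypV : val4_ge p (- 4) (y * p%:R)^-1.
Proof.
rewrite invfM -[- 4]add0r; apply: val4_geM => //; first exact/val4_ge_loc.
exact: (val4_ge_ppow p_pr (-1)).
Qed.

Lemma vp2_A0_ge e :
  (e%:E <= vp2 p A0)%E <-> val4_ge p (2 * e) n0 /\ val4_ge p (2 * e - 2) m0.
Proof.
split=> [/(vp2_ge p_pr) A0_ge | [n0_ge m0_ge]].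
  by have := A0_ge 0%N; have := A0_ge 1%N; rewrite mulr0 subr0 mulr1.
apply/vp2_ge => //= -[|[|i]]; rewrite ?mulr0 ?subr0 //.
by rewrite nth_default ?(leq_trans size_A0) //; exact: val4_ge0.
Qed.

(** The constant and the cubic coefficient of [A1 * phi] determine its second
    order valuation. *)
Lemma vp2_A1phi_ge e : (e%:E <= vp2 p (A1 * phi))%E <->
  val4_ge p (2 * e - 4) n1 /\ val4_ge p (2 * e - 6) m1.
Proof.
have def_A1phi : A1 * phi = (- (n1 * (y * p%:R)))%:P
    + (n1 * (z * p%:R) - m1 * (y * p%:R)) *: 'X
    + (n1 + m1 * (z * p%:R)) *: 'X^2 + m1 *: 'X^3.
  rewrite (linear_polyE size_A1) -/n1 -/m1 /phi -!mul_polyC.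
  by rewrite !(rmorphD, rmorphN, rmorphM) /=; ring.
have coefs i : (A1 * phi)`_i
    = [:: - (n1 * (y * p%:R)); n1 * (z * p%:R) - m1 * (y * p%:R);
          n1 + m1 * (z * p%:R); m1]`_i.
  rewrite def_A1phi !coefD !coefZ !coefXn coefX coefC.
  by case: i => [|[|[|[|i]]]] /=; rewrite ?mulr0 ?mulr1 ?addr0 ?add0r ?nth_nil.
split=> [/(vp2_ge p_pr) A1phi_ge | [n1_ge m1_ge]].
  have := A1phi_ge 0%N; have := A1phi_ge 3%N; rewrite !coefs /= => m1_ge n1yp_ge.
  split; last by apply: (val4_ge_le m1_ge); lia.
  have -> : n1 = - (n1 * (y * p%:R)) * - (y * p%:R)^-1.
    by field; apply/andP.
  by apply: (val4_ge_le (val4_geM p_pr n1yp_ge (val4_geN p_pr val4_ypV))); lia.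
apply/vp2_ge => // i; rewrite coefs.
case: i => [|[|[|[|i]]]] /=; last by rewrite nth_nil; exact: val4_ge0.
- by apply: val4_geN => //; apply: (val4_ge_le (val4_geM p_pr n1_ge val4_yp)); lia.
- apply: val4_geB => //.
    by apply: (val4_ge_le (val4_geM p_pr n1_ge val4_zp)); lia.
  by apply: (val4_ge_le (val4_geM p_pr m1_ge val4_yp)); lia.
- apply: val4_geD => //.
  by apply: (val4_ge_le (val4_geM p_pr m1_ge val4_zp)); lia.
by apply: (val4_ge_le m1_ge); lia.
Qed.

Lemma vp2_phi2 : vp2 p (phi ^+ 2) = 4%:E%E.
Proof.
have def_phi2 : phi ^+ 2 = ((y * p%:R) ^+ 2)%:P
    + (- (2 * (z * p%:R) * (y * p%:R))) *: 'X
    + ((z * p%:R) ^+ 2 - 2 * (y * p%:R)) *: 'X^2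
    + (2 * (z * p%:R)) *: 'X^3 + 'X^4.
  by rewrite /phi -!mul_polyC !(rmorphD, rmorphN, rmorphM, rmorphXn, rmorph_nat) /=; ring.
have coefs i : (phi ^+ 2)`_i
    = [:: (y * p%:R) ^+ 2; - (2 * (z * p%:R) * (y * p%:R));
          (z * p%:R) ^+ 2 - 2 * (y * p%:R); 2 * (z * p%:R); 1]`_i.
  rewrite def_phi2 !coefD !coefZ !coefXn coefX coefC.
  by case: i => [|[|[|[|[|i]]]]] /=; rewrite ?mulr0 ?mulr1 ?addr0 ?add0r ?nth_nil.
have val4_nat n : val4_ge p 0 n%:R by apply/val4_ge_loc => //; exact: Zloc_nat.
have val4_2zp := val4_geM p_pr (val4_nat 2) val4_zp; rewrite add0r in val4_2zp.
have val4_2yp := val4_geM p_pr (val4_nat 2) val4_yp; rewrite add0r in val4_2yp.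
have ge4 : (4%:E <= vp2 p (phi ^+ 2))%E.
  apply/vp2_ge => // i; rewrite coefs.
  case: i => [|[|[|[|[|i]]]]] /=; last by rewrite nth_nil; exact: val4_ge0.
  - by apply: (val4_ge_le (val4_geM p_pr val4_yp val4_yp)).
  - by apply: val4_geN => //; apply: (val4_ge_le (val4_geM p_pr val4_2zp val4_yp)).
  - apply: val4_geB => //.
    by apply: (val4_ge_le (val4_geM p_pr val4_zp val4_zp)).
  - exact: (val4_ge_le val4_2zp).
  exact: val4_nat 1%N.
have [|V vp2E] := @vp2_fin p (phi ^+ 2).
  by apply/eqP => /(congr1 (fun P : {poly rat} => P`_4)); rewrite coefs coef0 /=; lra.
move: ge4; rewrite vp2E lee_fin => ge4; congr (_%:E)%E; apply: le_anti.
rewrite ge4 andbT leNgt; apply/negP => V_gt4.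
have : (V%:E <= vp2 p (phi ^+ 2))%E by rewrite vp2E.
move/(vp2_ge p_pr)/(_ 4%N); rewrite coefs /= => one_ge.
have : val4_ge p 4 1 by apply: (@val4_ge_round _ p_pr 0 _ _ _ one_ge); lia.
move/(@val4_geE _ p_pr 1 4 _ isT isT); rewrite expr1z => pV_loc.
have := ratr_Fp_eq0 p_pr (Zloc_int p_pr 1).
by rewrite pV_loc (ratr_int _ 1) oner_eq0.
Qed.

(** The ordinates are given through their lower bounds, so that the minima that
    define them need not be computed. *)
Lemma newton_points2_spec : exists V : int,
  (forall e, e <= V <-> val4_ge p (2 * e) n0 /\ val4_ge p (2 * e - 2) m0) /\
  ((A1 = 0 /\ pts = [:: (0%N, V); (2%N, 4)]) \/
   exists W : int,
     (forall e, e <= W <-> val4_ge p (2 * e - 4) n1 /\ val4_ge p (2 * e - 6) m1) /\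
     pts = [:: (0%N, V); (1%N, W); (2%N, 4)]).
Proof.
have [V A0E] := vp2_fin p A0_neq0; exists V; split=> [e | ].
  by rewrite -vp2_A0_ge A0E lee_fin.
have phi_neq0 : phi != 0.
  apply/eqP => phi0; have := vp2_phi2; rewrite phi0 expr0n /= vp2_zero //.
rewrite /pts /newton_points2 /= expr0 mulr1 A0E /= expr1 mul1r vp2_phi2 /=.
have [-> | A1_neq0] := eqVneq A1 0; first left.
  by split; rewrite // mul0r vp2_zero /= expr0 mulr1 mul1r A0E vp2_phi2.
have [|W A1E] := @vp2_fin p (A1 * phi); first by rewrite mulf_neq0.
right; exists W; rewrite A1E /= expr0 mulr1 expr1 mul1r A0E A1E vp2_phi2; split=> // e.
by rewrite -vp2_A1phi_ge A1E lee_fin.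
Qed.

Let c1 := residue_c1 p y n1 m1.

Let val4_ypzV (k : int) : val4_ge p (- (4 * k)) ((y * p%:R) ^ k)^-1.
Proof. by rewrite invr_expz -mulrN; apply: val4_ge_unitz. Qed.

Lemma residue_c1_loc s : val4_ge p (2 * s) n1 -> val4_ge p (2 * s - 2) m1 ->
  c1 s \in Zloc p.
Proof.
move=> n1_ge m1_ge; apply/val4_ge_loc => //; rewrite /c1 /residue_c1.
have [[-> def_s] | [-> def_s]] := modz2P s; move: (s %/ 2)%Z def_s => m def_s /=.
  by apply: val4_ge_le (val4_geM p_pr n1_ge (val4_ypzV m)) _; lia.
by apply: val4_ge_le (val4_geM p_pr m1_ge (val4_ypzV m)) _; lia.
Qed.

(** If the coefficient of [A1] that can reach the height [s] vanishes modulo [p],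
    then both terms of [A1] lie higher. *)
Lemma residue_c1_dvd s : val4_ge p (2 * s) n1 -> val4_ge p (2 * s - 2) m1 ->
  c1 s / p%:R \in Zloc p ->
  val4_ge p (2 * s + 2) n1 /\ val4_ge p (2 * s) m1.
Proof.
move=> n1_ge m1_ge c1_dvd.
have {c1_dvd} : val4_ge p 4 (c1 s) by apply/(val4_ge_divp p_pr).
have ypz_ge m : val4_ge p (4 * m) ((y * p%:R) ^ m) by exact: val4_ge_unitz.
have ypz_neq0 m : (y * p%:R) ^ m != 0 by rewrite expfz_neq0 // mulf_neq0.
rewrite /c1 /residue_c1.
have [[-> def_s] | [-> def_s]] := modz2P s; move: (s %/ 2)%Z def_s => m def_s /= c1_ge.
  have := val4_geM p_pr c1_ge (ypz_ge m); rewrite divfK // => n1_ge'.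
  split; first by apply: val4_ge_le n1_ge' _; lia.
  by apply: (@val4_ge_round _ p_pr (m - 1) _ _ _ m1_ge); lia.
have := val4_geM p_pr c1_ge (ypz_ge m); rewrite divfK // => m1_ge'.
split; last by apply: val4_ge_le m1_ge' _; lia.
by apply: (@val4_ge_round _ p_pr m _ _ _ n1_ge); lia.
Qed.

Lemma residual_poly2_single (s : int) :
  residual_poly2 p y [:: A0; A1; 1] (0%N, (2 * s)%R) (2%N, 4)
  = 'X^2 + ratr (c1 s) *: 'X + (ratr (n0 / (y * p%:R) ^ s))%:P.
Proof.
rewrite /residual_poly2.
have -> : side_degree (0%N, (2 * s)%R) (2%N, 4) = 2%N.
  by rewrite /side_degree /= (_ : absz (4 - 2 * s)%R = (absz (2 - s)%R * 2)%N) ?gcdnMl //; lia.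
have slope : ((4 - 2 * s) %/ 2)%Z = 2 - s.
  by rewrite (_ : 4 - 2 * s = (2 - s) * 2) ?mulzK //; lia.
apply/polyP => j; rewrite coef_poly !coefD coefZ coefXn coefX coefC.
case: j => [|[|[|j]]] /=; last (by rewrite mulr0 !addr0); rewrite /residual_coef2 ?slope.
- rewrite mulr0 add0r mul0r mulr0 subr0 addr0 add0r.
  by rewrite [2 * s]mulrC modzMl mulzK.
- rewrite mulr1 add0r addr0; set e := 2 * s + _ - _.
  have -> : e = s by rewrite /e; lia.
  suff c1E : (if (s %% 2)%Z == 0 then n1 else m1) = A1`_`|(s %% 2)%Z|.
    by rewrite /c1 /residue_c1 c1E mulr1.
  by have [[-> _] | [-> _]] := modz2P s.
rewrite mulr0 !addr0; set e := 2 * s + _ - _.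
have -> : e = 0 by rewrite /e; lia.
by rewrite mod0z div0z expr0z coefC /= divr1 (ratr_int _ 1).
Qed.

(** [T ^+ 2 + c1 * T + c0] is the square of ['X - t] as soon as [t ^+ 2 = c0] and
    [2 * t = - c1]. *)
Lemma separable_residue (V s : int) : V = 2 * s ->
  val4_ge p (2 * V) n0 -> val4_ge p (2 * s) n1 -> val4_ge p (2 * s - 2) m1 ->
  separable_poly (residual_poly2 p y [:: A0; A1; 1] (0%N, V) (2%N, 4)) ->
  residually_separable p (- n0 / (y * p%:R) ^ s) (c1 s).
Proof.
move=> def_V n0_ge n1_ge m1_ge sep t t_loc dvd0 dvd1; move: sep.
rewrite def_V residual_poly2_single.
have c1_loc := residue_c1_loc n1_ge m1_ge.
have c0_loc : n0 / (y * p%:R) ^ s \in Zloc p.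
  apply/val4_ge_loc => //.
  by apply: val4_ge_le (val4_geM p_pr n0_ge (val4_ypzV s)) _; lia.
set c0 := n0 / _ in c0_loc *.
have /eqP : ratr (t ^+ 2 + - c0) == 0 :> 'F_p.
  rewrite ratr_Fp_eq0 //; last by rewrite ZlocB // ZlocX.
  by rewrite /c0 -mulNr.
have two_t_loc : 2 * t \in Zloc p by apply: ZlocM => //; exact: (Zloc_nat p_pr 2).
have /eqP : ratr (2 * t + c1 s) == 0 :> 'F_p.
  by rewrite ratr_Fp_eq0 // ZlocD.
rewrite ratr_FpD // ratr_FpM ?(Zloc_nat p_pr 2) // (ratr_nat _ 2).
move/eqP; rewrite addrC addr_eq0 => /eqP ->.
rewrite ratr_FpD ?ZlocX ?ZlocN // ratr_FpN // expr2 ratr_FpM //.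
move/eqP; rewrite subr_eq0 => /eqP <-.
have -> : 'X^2 + - (2 * ratr t) *: 'X + (ratr t * ratr t)%:P
    = ('X - (ratr t)%:P) * ('X - (ratr t)%:P) :> {poly 'F_p}.
  by rewrite -mul_polyC !(rmorphN, rmorphM, rmorph_nat) /=; ring.
by rewrite separable_root root_XsubC eqxx andbF.
Qed.

(** The alternative to [h = V] is that the point of abscissa 1 is a vertex, of
    ordinate exactly [s + 2]. Then [C0] is 0 modulo [p], so a double root would
    be 0 and [c1] would vanish too, against the exactness. If [h] is odd it is
    [V], and only [m0 * 'X] can have an odd second order valuation. *)
Lemma regular_residue_polygon (V h : int) :
  (forall e, e <= V <-> val4_ge p (2 * e) n0 /\ val4_ge p (2 * e - 2) m0) ->
  h <= V -> val4_ge p h n1 -> val4_ge p (h - 2) m1 ->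
  (h = V \/ exists2 s, h = 2 * s &
     ~ (val4_ge p (2 * s + 2) n1 /\ val4_ge p (2 * s) m1)) ->
  (h = V -> is_side pts (0%N, V) (2%N, 4)) ->
  phi_regular2 p y phi [:: A0; A1; 1] ->
  regular_residue p h y (- n0) (- m0) n1 m1.
Proof.
move=> V_spec le_hV n1_ge m1_ge V_or side reg.
have [n0_ge m0_ge] := (V_spec V).1 (lexx V).
split=> s def_h.
  rewrite def_h in n1_ge m1_ge.
  have [hV | lt_hV] := eqVneq h V.
    apply: (separable_residue (V := V)) => //; first by rewrite -hV.
    exact/reg/side.
  case: V_or => [/eqP | [s' def_s' exact_W]]; first by rewrite (negPf lt_hV).
  have eq_s : s' = s by move: def_h def_s'; clear; lia.
  rewrite eq_s in exact_W.
  move=> t t_loc dvd0 dvd1; case: exact_W; apply: residue_c1_dvd => //.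
  have c0_dvd : n0 / (y * p%:R) ^ s / p%:R \in Zloc p.
    apply/(val4_ge_divp p_pr (e := 4)) => //; have n0_ge' : val4_ge p (4 * s + 4) n0.
      apply: (@val4_ge_round _ p_pr s _ _ _ n0_ge); last by lia.
      by move: lt_hV le_hV def_h; clear; lia.
    by apply: val4_ge_le (val4_geM p_pr n0_ge' (val4_ypzV s)) _; clear; lia.
  have t2_dvd : t ^+ 2 / p%:R \in Zloc p.
    have -> : t ^+ 2 / p%:R = (t ^+ 2 + - n0 / (y * p%:R) ^ s) / p%:R
        + n0 / (y * p%:R) ^ s / p%:R by rewrite -mulrDl mulNr subrK.
    exact: ZlocD.
  have t_dvd : t / p%:R \in Zloc p.
    move: t2_dvd; rewrite -!ratr_Fp_eq0 ?ZlocX // expr2 ratr_FpM //.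
    by rewrite mulf_eq0 orbb.
  rewrite (_ : c1 s / p%:R = (2 * t + c1 s) / p%:R - 2 * (t / p%:R)).
    by apply: ZlocB => //; apply: ZlocM => //; exact: (Zloc_nat p_pr 2).
  by rewrite mulrDl mulrA addrAC subrr add0r.
case: V_or => [hV | [s' def_s' _]]; last by move: def_h def_s'; clear; lia.
rewrite hV => /(val4_geN p_pr); rewrite opprK => m0_ge'.
suff : V + 1 <= V by clear; lia.
apply/V_spec; split.
  by apply: (@val4_ge_round _ p_pr s _ _ _ n0_ge); move: hV def_h; clear; lia.
have [[_ def_s] | [_ def_s]] := modz2P s; move: (s %/ 2)%Z def_s => m def_s.
  by apply: (@val4_ge_round _ p_pr (2 * m) _ _ _ m0_ge');
    move: hV def_h def_s; clear; lia.
by apply: (@val4_ge_round _ p_pr (2 * m + 1) _ _ _ m0_ge');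
  move: hV def_h def_s; clear; lia.
Qed.

Lemma envelope_two (V : int) (Y : rat) :
  on_lower_envelope [:: (0%N, V); (2%N, 4)] 1 Y -> Y = (V%:~R + 4) / 2.
Proof.
case=> [[w []]] _; rewrite !big_cons !big_nil /= => sum_w abs_w ord_w _.
have [w0 w2] : w (0%N, V) = 1 / 2 /\ w (2%N, 4) = 1 / 2 by split; lra.
by move: ord_w; rewrite w0 w2; lra.
Qed.

(** A combination of abscissa 1 gives the same weight to both end points, so its
    ordinate is a mean of the middle point and of the midpoint of the other two. *)
Lemma envelope_three (V W : int) (Y : rat) :
  on_lower_envelope [:: (0%N, V); (1%N, W); (2%N, 4)] 1 Y ->
  Y = Num.min ((V%:~R + 4) / 2) W%:~R.
Proof.
case=> [[w [w_ge0]]]; rewrite !big_cons !big_nil /= => sum_w abs_w ord_w min_Y.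
have le_Y1 : Y <= (V%:~R + 4) / 2.
  apply: min_Y; exists (fun P => if P.1 == 1%N then 0 else 1 / 2).
  by rewrite !big_cons !big_nil /=; split=> [P | | | ]; [case: ifP|..]; lra.
have le_Y2 : Y <= W%:~R.
  apply: min_Y; exists (fun P => if P.1 == 1%N then 1 else 0).
  by rewrite !big_cons !big_nil /=; split=> [P | | | ]; [case: ifP|..]; lra.
have w0_ge0 := w_ge0 (0%N, V); have w1_ge0 := w_ge0 (1%N, W).
case: (leP ((V%:~R + 4) / 2) W%:~R) => [le_VW | lt_WV].
  have := mulr_ge0 w1_ge0 (_ : 0 <= W%:~R - (V%:~R + 4) / 2); nra.
have := mulr_ge0 w0_ge0 (_ : 0 <= (V%:~R + 4) / 2 - W%:~R); nra.
Qed.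

(** The bounds on the four coefficients only serve to get [4 < h]. *)
Lemma newton_polygon_filtration (Y : rat) :
  val4_ge p 12 n0 -> val4_ge p 8 m0 -> val4_ge p 8 n1 -> val4_ge p 4 m1 ->
  on_lower_envelope pts 1 Y -> phi_regular2 p y phi [:: A0; A1; 1] ->
  exists h : int, [/\ Y = h%:~R / 2 + 2, 4 < h,
    val4_ge p (2 * h) n0 /\ val4_ge p (2 * h - 2) m0,
    val4_ge p h n1 /\ val4_ge p (h - 2) m1
    & regular_residue p h y (- n0) (- m0) n1 m1].
Proof.
move=> n0_12 m0_8 n1_8 m1_4 Y_env reg.
have [V [V_spec pts_spec]] := newton_points2_spec.
have V_ge5 : 5 <= V.
  by apply/V_spec; split; [apply: val4_ge_le n0_12 _ | apply: val4_ge_le m0_8 _].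
have [n0_ge m0_ge] := (V_spec V).1 (lexx V).
have low h : h <= V -> val4_ge p (2 * h) n0 /\ val4_ge p (2 * h - 2) m0.
  by move=> le_h; split; [apply: val4_ge_le n0_ge _ | apply: val4_ge_le m0_ge _]; lia.
case: pts_spec => [[A1_0 def_pts] | [W [W_spec def_pts]]].
  have n1_ge e : val4_ge p e n1 by rewrite /n1 A1_0 coef0; exact: val4_ge0.
  have m1_ge e : val4_ge p e m1 by rewrite /m1 A1_0 coef0; exact: val4_ge0.
  exists V; split=> //; first by rewrite def_pts in Y_env; rewrite (envelope_two Y_env); lra.
  apply: regular_residue_polygon V_spec _ _ _ _ _ reg => //; first by left.
  move=> _; rewrite def_pts; split; rewrite ?inE ?eqxx ?orbT // => S.
  rewrite !inE => /orP[] /eqP-> /=.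
    by rewrite /line_through /= rmorphB /= ?subr0; lra.
  by rewrite /line_through /= rmorphB /= ?subr0; lra.
have W_ge5 : 5 <= W.
  by apply/W_spec; split; [apply: val4_ge_le n1_8 _ | apply: val4_ge_le m1_4 _].
have [n1_ge m1_ge] := (W_spec W).1 (lexx W).
rewrite def_pts in Y_env; have := envelope_three Y_env.
have [le_VW | lt_WV] := leP (V + 4) (2 * W).
  have le_VWq : (V%:~R + 4) / 2 <= W%:~R :> rat.
    move: le_VW; rewrite -(ler_int rat) !(rmorphD, rmorphM) /=; lra.
  rewrite min_l // => def_Y; exists V.
  have n1_V : val4_ge p V n1 by apply: val4_ge_le n1_ge _; lia.
  have m1_V : val4_ge p (V - 2) m1 by apply: val4_ge_le m1_ge _; lia.
  split=> //; first by rewrite def_Y; lra.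
  apply: regular_residue_polygon V_spec _ _ _ _ _ reg => //; first by left.
  move=> _; rewrite def_pts; split; rewrite ?inE ?eqxx ?orbT // => S.
  rewrite !inE => /or3P[] /eqP-> /=;
    rewrite /line_through /= rmorphB /= ?subr0; lra.
have lt_WVq : W%:~R < (V%:~R + 4) / 2 :> rat.
  move: lt_WV; rewrite -(ltr_int rat) !(rmorphD, rmorphM) /=; lra.
rewrite min_r ?ltW // => def_Y; exists (2 * W - 4).
have n1_h : val4_ge p (2 * W - 4) n1 by [].
have m1_h : val4_ge p (2 * W - 4 - 2) m1 by apply: val4_ge_le m1_ge _; lia.
split=> //.
- by rewrite def_Y rmorphB rmorphM /=; lra.
- by lia.
- by apply: low; lia.
apply: regular_residue_polygon V_spec _ _ _ _ _ reg => //; try by lia.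
right; exists (W - 2); first by lia.
move=> [n1_ge' m1_ge']; suff : W + 1 <= W by lia.
apply/W_spec; split.
  by apply: val4_ge_le n1_ge' _; lia.
by apply: val4_ge_le m1_ge' _; lia.
Qed.

End NewtonPolygon.

(** * The integral basis *)

Lemma double_root_coefs (F : fieldType) (b c t : F) :
  mup t ('X^2 + b *: 'X + c%:P) = 2%N -> b = - (2 * t) /\ c = t ^+ 2.
Proof.
set R := _ + _ => mup_R.
have R_neq0 : R != 0.
  apply/eqP => /(congr1 (fun P : {poly F} => P`_2)).
  rewrite !coefD coefZ coefXn coefX coefC coef0 /= mulr0 !addr0.
  by move/eqP; rewrite oner_eq0.
have dvd_R : ('X - t%:P) ^+ 2 %| R by rewrite -mup_geq ?mup_R.
have def_D : R - ('X - t%:P) ^+ 2 = (b + 2 * t) *: 'X + (c - t ^+ 2)%:P.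
  rewrite /R -!mul_polyC.
  by rewrite !(rmorphD, rmorphN, rmorphM, rmorphXn, rmorph_nat) /=; ring.
have D0 : R - ('X - t%:P) ^+ 2 = 0.
  have : ('X - t%:P) ^+ 2 %| R - ('X - t%:P) ^+ 2 by rewrite dvdp_sub.
  apply: contraTeq => D_neq0; rewrite gtNdvdp // size_exp_XsubC ltnS def_D.
  apply: leq_trans (size_polyD _ _) _; rewrite geq_max.
  rewrite (leq_trans (size_scale_leq _ _)) ?size_polyX //.
  by rewrite (leq_trans (size_polyC_leq1 _)).
have coefs i : ((b + 2 * t) *: 'X + (c - t ^+ 2)%:P)`_i = 0.
  by rewrite -def_D D0 coef0.
have := coefs 0%N; have := coefs 1%N; rewrite !(coefD, coefZ, coefX, coefC) /=.
rewrite mulr1 mulr0 addr0 add0r => /eqP; rewrite addr_eq0 => /eqP -> /eqP.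
by rewrite subr_eq0 => /eqP ->.
Qed.

Theorem theorem5p1 (p : nat) (a0 a1 a2 a3 : int) (F : {poly int})
    (theta : algC) (R : {poly 'F_p}) (y z : rat)
    (phi A0 A1 Q : {poly rat}) (Y nu : rat) :
  prime p ->
  F = 'X^4 + a3 *: 'X^3 + a2 *: 'X^2 + a1 *: 'X + a0%:P ->
  irreducible_poly (map_poly intr F : {poly rat}) ->
  root (map_poly intr F) theta ->
  vp p a0%:~R = 2%:E%E ->
  (1%:E < vp p a1%:~R)%E ->
  (1%:E <= vp p a2%:~R)%E ->
  (1%:E <= vp p a3%:~R)%E ->
  R = 'X^2 + ratr (a2%:~R / p%:R) *: 'X + (ratr (a0%:~R / p%:R ^+ 2))%:P ->
  ~~ separable_poly R ->
  y \in Zloc p ->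
  mup (ratr y) R = 2%N ->
  z \in Zloc p ->
  phi = 'X^2 + (z * p%:R) *: 'X - (y * p%:R)%:P ->
  A0 \is a polyOver (Zloc p) ->
  A1 \is a polyOver (Zloc p) ->
  (size A0 <= 2)%N ->
  (size A1 <= 2)%N ->
  map_poly intr F = phi ^+ 2 + A1 * phi + A0 ->
  Q = phi + A1 ->
  on_lower_envelope (newton_points2 p phi [:: A0; A1; 1]) 1 Y ->
  phi_regular2 p y phi [:: A0; A1; 1] ->
  nu = Y / 2 - 1 ->
  p_integral_basis p (Qadjoin theta)
    [tuple 1;
           theta;
           (map_poly ratr Q).[theta] / p%:R ^ Num.floor nu;
           theta * (map_poly ratr Q).[theta] / p%:R ^ Num.floor (nu + 1 / 2)].
Proof.
move=> p_pr def_F F_irr F_theta vp_a0 vp_a1 vp_a2 vp_a3 def_R _ y_loc mup_R.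
move=> z_loc def_phi _ _ size_A0 size_A1 dev_F def_Q Y_env reg def_nu.
have p_neq0 : p%:R != 0 :> rat by rewrite pnatr_eq0 -lt0n prime_gt0.
set n0 := A0`_0; set m0 := A0`_1; set n1 := A1`_0; set m1 := A1`_1.
have def_A0 : A0 = n0%:P + m0 *: 'X := linear_polyE size_A0.
have def_A1 : A1 = n1%:P + m1 *: 'X := linear_polyE size_A1.
have val4_p : val4_ge p 4 p%:R := val4_ge_ppow p_pr 1.
have val4_loc c : c \in Zloc p -> val4_ge p 4 (c * p%:R).
  by move=> c_loc; rewrite -[4]add0r; apply: val4_geM => //; apply/val4_ge_loc.
have val4_zp := val4_loc z z_loc; have val4_yp := val4_loc y y_loc.
(* The double root [y] of [R] is a unit, and [a2] and [a0] are congruent to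
   [- 2 * y * p] and [(y * p) ^ 2], one power of [p] more than for free. *)
have a2_loc : a2%:~R / p%:R \in Zloc p by rewrite -[p%:R]expr1z -vp_ge.
have a0_loc : a0%:~R / p%:R ^+ 2 \in Zloc p by rewrite -(vp_ge p_pr 2) vp_a0.
rewrite def_R in mup_R; have [a2_y a0_y] := double_root_coefs mup_R.
have y_unit : y / p%:R \notin Zloc p.
  rewrite -ratr_Fp_eq0 //; apply/negP => /eqP y0.
  move/eqP: a0_y; rewrite y0 expr0n /= ratr_Fp_eq0 //.
  rewrite (_ : _ / _ / _ = a0%:~R / p%:R ^ 3); last first.
    by rewrite -exprnP; field.
  by rewrite -vp_ge // vp_a0.
have yV_loc := Zloc_inv p_pr y_loc y_unit.
have y_neq0 : y != 0.
  by apply: contraNneq y_unit => ->; rewrite mul0r (Zloc_int p_pr 0).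
have two_loc : 2 \in Zloc p := Zloc_nat p_pr 2.
have a2_dvd : (a2%:~R / p%:R + 2 * y) / p%:R \in Zloc p.
  have two_y_loc : 2 * y \in Zloc p by exact: ZlocM.
  rewrite -ratr_Fp_eq0; [|by []|exact: ZlocD].
  by rewrite ratr_FpD // a2_y ratr_FpM // (ratr_nat _ 2) addNr.
have a0_dvd : (a0%:~R / p%:R ^+ 2 - y ^+ 2) / p%:R \in Zloc p.
  have y2_loc : y ^+ 2 \in Zloc p by exact: ZlocX.
  rewrite -ratr_Fp_eq0; [|by []|exact: ZlocB].
  by rewrite ratr_FpD ?ZlocN // ratr_FpN // a0_y [y ^+ 2]expr2 ratr_FpM // expr2 subrr.
(* Comparing coefficients in [F = phi ^ 2 + A1 * phi + A0] expresses those of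
   [A1] and [A0] by [a3], [a2], [a1], [a0]; the previous congruences make them
   divisible by [p], [p ^ 2], [p ^ 2] and [p ^ 3]. *)
set G : {poly rat} := map_poly intr F in F_irr dev_F.
have def_G : G = 'X^4 + a3%:~R *: 'X^3 + a2%:~R *: 'X^2 + a1%:~R *: 'X + (a0%:~R)%:P.
  by rewrite /G def_F !rmorphD /= !map_polyZ !map_polyXn map_polyX map_polyC.
have dev_G : G = 'X^4 + (2 * (z * p%:R) + m1) *: 'X^3
    + ((z * p%:R) ^+ 2 - 2 * (y * p%:R) + n1 + m1 * (z * p%:R)) *: 'X^2
    + (- (2 * (z * p%:R) * (y * p%:R)) + n1 * (z * p%:R) - m1 * (y * p%:R) + m0) *: 'X
    + ((y * p%:R) ^+ 2 - n1 * (y * p%:R) + n0)%:P.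
  rewrite dev_F def_phi def_A0 def_A1 -!mul_polyC.
  by rewrite !(rmorphD, rmorphN, rmorphM, rmorphXn, rmorph_nat) /=; ring.
have coef_eq i := congr1 (fun P : {poly rat} => P`_i) (etrans (esym def_G) dev_G).
have := coef_eq 0%N; have := coef_eq 1%N; have := coef_eq 2%N; have := coef_eq 3%N.
rewrite !(coefD, coefZ, coefXn, coefX, coefC) /= !(mulr0, mulr1, addr0, add0r).
move=> {coef_eq} def_a3 def_a2 def_a1 def_a0.
have m1_4 : val4_ge p 4 m1.
  have -> : m1 = a3%:~R - 2 * z * p%:R by rewrite def_a3; ring.
  apply: val4_geB => //; last by apply: val4_loc; rewrite ZlocM.
  exact/(val4_ge_vp p_pr 1).
have n1_8 : val4_ge p 8 n1.
  have -> : n1 = (a2%:~R / p%:R + 2 * y) / p%:R * p%:R * p%:R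
      - ((z * p%:R) * (z * p%:R) + m1 * (z * p%:R)).
    by rewrite def_a2; field.
  apply: val4_geB => //; last apply: val4_geD => //.
  - by apply: (val4_geM p_pr (val4_loc _ a2_dvd) val4_p).
  - exact: (val4_geM p_pr val4_zp val4_zp).
  exact: (val4_geM p_pr m1_4 val4_zp).
have m0_8 : val4_ge p 8 m0.
  have -> : m0 = a1%:~R + 2 * z * p%:R * (y * p%:R) - n1 * (z * p%:R) + m1 * (y * p%:R).
    by rewrite def_a1; ring.
  apply: val4_geD => //; last exact: (val4_geM p_pr m1_4 val4_yp).
  apply: val4_geB => //; last by apply: val4_ge_le (val4_geM p_pr n1_8 val4_zp) _.
  apply: val4_geD => //; last first.
    by apply: (@val4_geM _ p_pr 4 4) => //; apply: val4_loc; rewrite ZlocM.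
  apply/(val4_ge_vp p_pr 2).
  by case: (vp p a1%:~R) vp_a1 => // v; rewrite lte_fin lee_fin.
have n0_12 : val4_ge p 12 n0.
  have -> : n0 = (a0%:~R / p%:R ^+ 2 - y ^+ 2) / p%:R * p%:R * p%:R * p%:R
      + n1 * (y * p%:R).
    by rewrite def_a0; field.
  apply: val4_geD => //; last exact: (val4_geM p_pr n1_8 val4_yp).
  apply: (@val4_geM _ p_pr 8 4) => //; apply: (@val4_geM _ p_pr 4 4) => //.
  exact: val4_loc.
have size_phi : size phi = 3%N.
  rewrite def_phi -addrA size_polyDl ?size_polyXn // ltnS.
  apply: leq_trans (size_polyD _ _) _; rewrite geq_max size_polyN.
  rewrite (leq_trans (size_scale_leq _ _)) ?size_polyX //.
  by rewrite (leq_trans (size_polyC_leq1 _)).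
have size_G : size G = 5%N.
  rewrite def_G -!addrA size_polyDl ?size_polyXn // ltnS.
  do 2![apply: leq_trans (size_polyD _ _) _;
        rewrite geq_max (leq_trans (size_scale_leq _ _)) ?size_polyXn //=].
  apply: leq_trans (size_polyD _ _) _; rewrite geq_max.
  rewrite (leq_trans (size_scale_leq _ _)) ?size_polyX //.
  by rewrite (leq_trans (size_polyC_leq1 _)).
have A0_neq0 : A0 != 0.
  apply/eqP => A0_0; have phi_G : phi %| G.
    by apply/dvdpP; exists (phi + A1); rewrite dev_F A0_0; ring.
  have /eqp_size : phi %= G by apply: F_irr.2 phi_G; rewrite size_phi.
  by rewrite size_phi size_G.
rewrite def_phi in Y_env reg.
have [h [def_Y h_gt4 [n0_ge m0_ge] [n1_ge m1_ge] h_reg]] :=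
  newton_polygon_filtration p_pr y_neq0 y_loc yV_loc z_loc A0_neq0 size_A0 size_A1
    n0_12 m0_8 n1_8 m1_4 Y_env reg.
have G_theta : root (map_poly ratr G) theta.
  rewrite -map_poly_comp (eq_map_poly (g := intr)) // => a.
  by rewrite /= ratr_int.
have def_Q2 : Q = 'X^2 + (z * p%:R + m1) *: 'X + (n1 - y * p%:R)%:P.
  rewrite def_Q def_phi def_A1 -!mul_polyC.
  by rewrite !(rmorphD, rmorphN, rmorphM) /=; ring.
have ev_Q : (map_poly ratr Q).[theta]
    = theta ^+ 2 + ratr (z * p%:R + m1) * theta + ratr (n1 - y * p%:R).
  rewrite def_Q2 !rmorphD /= map_polyZ map_polyXn map_polyX !map_polyC /=.
  by rewrite !hornerD !hornerZ hornerXn hornerX !hornerC rmorphD.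
have ev_linear (c d : rat) :
    (map_poly ratr (c%:P + d *: 'X)).[theta] = ratr c + ratr d * theta :> algC.
  rewrite rmorphD /= map_polyZ map_polyX map_polyC /=.
  by rewrite hornerD hornerZ hornerX hornerC.
have ev_G : (map_poly ratr Q).[theta] ^+ 2
    = (map_poly ratr A1).[theta] * (map_poly ratr Q).[theta] - (map_poly ratr A0).[theta].
  have : (map_poly ratr (Q ^+ 2 - A1 * Q + A0)).[theta] = 0.
    rewrite (_ : _ + _ = G); first exact/rootP.
    by rewrite dev_F def_Q; ring.
  rewrite rmorphD rmorphB rmorphXn rmorphM !hornerD hornerN horner_exp hornerM.
  by move/eqP; rewrite addr_eq0 subr_eq addrC => /eqP.
rewrite def_A0 def_A1 !ev_linear in ev_G.
have := floor_itv nu; have := floor_itv (nu + 1 / 2).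
set f := Num.floor nu; set f' := Num.floor (nu + 1 / 2).
have def_nu4 : nu = h%:~R / 4 by rewrite def_nu def_Y; field.
rewrite def_nu4 !rmorphD /= => /andP[f'_le f'_gt] /andP[f_le f_gt].
rewrite def_Q2 in ev_Q ev_G *.
apply: (integral_tuple_basis p_pr y_neq0 y_loc yV_loc h_gt4 (g0 := - n1)
  (g1 := - (z * p%:R + m1)) (n0 := - n0) (m0 := - m0) (n1 := n1) (m1 := m1)) => //.
- by rewrite ev_Q; ring.
- by apply: val4_geN => //; apply: val4_ge_le n1_8 _.
- apply: val4_geN => //; apply: val4_ge_le (_ : val4_ge p 4 _) _ => //.
  exact: val4_geD.
- by rewrite ev_G !rmorphN /=; ring.
- exact: val4_geN.
- exact: val4_geN.
- exact: quartic_free F_irr size_G G_theta.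
- by rewrite -(ler_int rat) rmorphM /=; lra.
- by rewrite -(ltr_int rat) rmorphD rmorphM /=; lra.
- by rewrite -(ler_int rat) rmorphD rmorphM /=; lra.
- by rewrite -(ltr_int rat) !rmorphD rmorphM /=; lra.
exact: Qadjoin_lincomb4 F_irr size_G G_theta.
Qed.
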